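(* Let $\theta\in\mathbb R\setminus\mathbb Q$ and let $\Gamma$ be one of the cyclic subgroups $\mathbb Z_3,\mathbb Z_4,\mathbb Z_6$ of $SL(2,\mathbb Z)$ described in the context, acting on $\mathcal A_\theta^{alg}$. Then the Hochschild cohomology of $B=\mathcal A_\theta^{alg}\rtimes\Gamma$ with coefficients in its dual bimodule $B^\ast$ satisfies: $H^0(B,B^\ast)\cong\mathbb C^7$ for $\Gamma=\mathbb Z_3$, $\cong\mathbb C^8$ for $\Gamma=\mathbb Z_4$, $\cong\mathbb C^9$ for $\Gamma=\mathbb Z_6$; $H^1(B,B^\ast)\cong 0$ for $\Gamma=\mathbb Z_3,\mathbb Z_4,\mathbb Z_6$; $H^2(B,B^\ast)\cong\mathbb C$ for $\Gamma=\mathbb Z_3,\mathbb Z_4,\mathbb Z_6$; $H^k(B,B^\ast)\cong 0$ for all $k>3$ and $\Gamma=\mathbb Z_3,\mathbb Z_4,\mathbb Z_6$.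
   Context: Let $\lambda=e^{2\pi i\theta}$ and for $s\in\mathbb R$ write $\lambda^s:=e^{2\pi i\theta s}$. The algebraic noncommutative torus $\mathcal A_\theta^{alg}$ is the complex algebra of finite sums $\sum_{(n,m)\in\mathbb Z^2}a_{n,m}U_1^nU_2^m$, where $U_1,U_2$ are invertible (unitary) generators with $U_2U_1=\lambda U_1U_2$. An element $g=\begin{pmatrix}g_{11}&g_{12}\\ g_{21}&g_{22}\end{pmatrix}\in SL(2,\mathbb Z)$ acts by the automorphism determined by $g\cdot U_1=e^{\pi i g_{11}g_{21}\theta}U_1^{g_{11}}U_2^{g_{21}}$, $g\cdot U_2=e^{\pi i g_{12}g_{22}\theta}U_1^{g_{12}}U_2^{g_{22}}$. The subgroup $\mathbb Z_3$ is generated by $\omega=\begin{pmatrix}0&1\\-1&-1\end{pmatrix}$ (so $U_1\mapsto U_2^{-1}$, $U_2\mapsto\lambda^{-1/2}U_1U_2^{-1}$); $\mathbb Z_4$ is generated by an element acting by $U_1\mapsto U_2^{-1}$, $U_2\mapsto U_1$; $\mathbb Z_6$ is generated by $-\omega=\begin{pmatrix}0&-1\\1&1\end{pmatrix}$ (so $U_1\mapsto U_2$, $U_2\mapsto\lambda^{-1/2}U_1^{-1}U_2$). The crossed product $\mathcal A_\theta^{alg}\rtimes\Gamma$ is $\mathcal A_\theta^{alg}\otimes\mathbb C\Gamma$ with product $(a\otimes g)(b\otimes h)=a(g\cdot b)\otimes gh$. For an algebra $B$, $B^\ast=\mathrm{Hom}_{\mathbb C}(B,\mathbb C)$ is the $B$-bimodule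 with $(b\cdot f\cdot c)(x)=f(cxb)$, and $H^\bullet(B,B^\ast)$ denotes Hochschild cohomology. *)

(* Defs.v *)
From HB Require Import structures.
From mathcomp Require Import all_boot all_algebra.
From mathcomp Require Import finmap.
From mathcomp Require Import reals trigo complex Rstruct.

Set Implicit Arguments.
Unset Strict Implicit.
Unset Printing Implicit Defensive.

Import GRing.Theory Num.Theory.
Local Open Scope ring_scope.

Definition CC := (Rdefinitions.R)[i].

Definition lampow (theta s : Rdefinitions.R) : CC :=
  Complex (cos (2 * pi * theta * s)) (sin (2 * pi * theta * s)).

Definition mx2 (a b c d : int) : 'M[int]_2 :=
  \matrix_(i < 2, j < 2)
    if (i : nat) == 0%N then (if (j : nat) == 0%N then a else b)
    else (if (j : nat) == 0%N then c else d).

(* generator of Gamma = Z_k, k in {3,4,6}: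
   k = 3 : omega = [[0,1],[-1,-1]]
   k = 4 : [[0,1],[-1,0]]  (U1 -> U2^-1, U2 -> U1)
   k = 6 : -omega = [[0,-1],[1,1]] *)
Definition gen (k : nat) : 'M[int]_2 :=
  if k == 3%N then mx2 0 1 (-1) (-1)
  else if k == 4%N then mx2 0 1 (-1) 0
  else if k == 6%N then mx2 0 (-1) 1 1
  else 1.

(* Gamma = Z_k is realised as 'I_k, element j standing for (gen k)^j *)
Definition gmat (k : nat) (j : 'I_k) : 'M[int]_2 := (gen k) ^+ j.

Definition gmul (k : nat) (j h : 'I_k) : 'I_k :=
  Ordinal (ltn_pmod (j + h)%N (leq_ltn_trans (leq0n j) (ltn_ord j))).

(* Basis: U1^n U2^m (x) g, indexed by (n, m, g).                       *)

Definition basis (k : nat) := (int * int * 'I_k)%type.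

(* g . (U1^p U2^q) = lambda^{(a b - p q)/2} U1^a U2^b  where (a,b)^T = g (p,q)^T.
   This is the value of the automorphism determined by
   g.U1 = e^{pi i g11 g21 theta} U1^g11 U2^g21, g.U2 = e^{pi i g12 g22 theta} U1^g12 U2^g22. *)
Definition act_vec (M : 'M[int]_2) (p q : int) : int * int :=
  (M 0 0 * p + M 0 1 * q, M 1 0 * p + M 1 1 * q).

Definition act_coef (theta : Rdefinitions.R) (M : 'M[int]_2) (p q : int) : CC :=
  let ab := act_vec M p q in
  lampow theta (((ab.1 * ab.2 - p * q)%:~R) / 2).

(* product of basis elements in the crossed product:
   (U1^p1 U2^q1 (x) g)(U1^p2 U2^q2 (x) h)
     = U1^p1 U2^q1 (g.(U1^p2 U2^q2)) (x) gh
     = lambda^{(ab - p2 q2)/2} lambda^{q1 a} U1^{p1+a} U2^{q1+b} (x) gh,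
   using U2^m U1^n = lambda^{m n} U1^n U2^m. *)
Definition bmulT (theta : Rdefinitions.R) (k : nat) (t1 t2 : basis k) : CC * basis k :=
  let: (p1, q1, g) := t1 in
  let: (p2, q2, h) := t2 in
  let ab := act_vec (gmat g) p2 q2 in
  (act_coef theta (gmat g) p2 q2 * lampow theta ((q1 * ab.1)%:~R),
   (p1 + ab.1, q1 + ab.2, gmul g h)).

Definition Alg (k : nat) := {fsfun basis k -> CC with 0}.

Definition badd (k : nat) (f g : Alg k) : Alg k :=
  [fsfun t in (finsupp f `|` finsupp g)%fset => f t + g t].

Definition bscale (k : nat) (a : CC) (f : Alg k) : Alg k :=
  [fsfun t in finsupp f => a * f t].

Definition bmul (theta : Rdefinitions.R) (k : nat) (f g : Alg k) : Alg k :=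
  [fsfun t in [fset (bmulT theta t1 t2).2 | t1 in finsupp f, t2 in finsupp g]%fset =>
     \sum_(t1 <- finsupp f) \sum_(t2 <- finsupp g)
        (if (bmulT theta t1 t2).2 == t then (bmulT theta t1 t2).1 * f t1 * g t2 else 0)].

(* C^n(B,B^* ) = Hom(B^{(x)n}, B^* ): an n-cochain is represented as   *)
(* phi : (nat -> B) -> B -> C,  phi b x = phi(b_0,...,b_{n-1})(x),     *)
(* depending only on b_0..b_{n-1}, multilinear in these, linear in x.  *)
(* Bimodule structure on B^*: (b.f.c)(x) = f(c x b).                   *)

Section Hochschild.
Variables (B : Type) (add : B -> B -> B) (scale : CC -> B -> B) (mul : B -> B -> B).

Definition upd (b : nat -> B) (i : nat) (u : B) : nat -> B :=
  fun j => if j == i then u else b j.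

Definition cochain (n : nat) (phi : (nat -> B) -> B -> CC) : Prop :=
  [/\ (forall b b' : nat -> B, (forall i, (i < n)%N -> b i = b' i) ->
         forall x, phi b x = phi b' x),
      (forall (b : nat -> B) (i : nat), (i < n)%N -> forall (a : CC) (u v x : B),
         phi (upd b i (add (scale a u) v)) x = a * phi (upd b i u) x + phi (upd b i v) x) &
      (forall (b : nat -> B) (a : CC) (u v : B),
         phi b (add (scale a u) v) = a * phi b u + phi b v)].

Definition contract (b : nat -> B) (i : nat) : nat -> B :=
  fun j => if (j < i)%N then b j else if j == i then mul (b i) (b i.+1) else b j.+1.

(* Hochschild differential C^n -> C^{n+1}:
   (d phi)(b_1..b_{n+1}) = b_1 . phi(b_2..b_{n+1})
        + sum_{i=1}^n (-1)^i phi(b_1,..,b_i b_{i+1},..,b_{n+1})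
        + (-1)^{n+1} phi(b_1..b_n) . b_{n+1}   (here 0-based) *)
Definition hdelta (n : nat) (phi : (nat -> B) -> B -> CC) : (nat -> B) -> B -> CC :=
  fun b x =>
    phi (fun j => b j.+1) (mul x (b 0%N))
    + \sum_(i < n) (-1) ^+ i.+1 * phi (contract b i) x
    + (-1) ^+ n.+1 * phi b (mul (b n) x).

Definition cocycle (n : nat) (phi : (nat -> B) -> B -> CC) : Prop :=
  cochain n phi /\ forall b x, hdelta n phi b x = 0.

Definition coboundary (n : nat) (phi : (nat -> B) -> B -> CC) : Prop :=
  match n with
  | 0%N => forall b x, phi b x = 0
  | m.+1 => exists psi, cochain m psi /\ forall b x, phi b x = hdelta m psi b x
  end.

(* H^n(B,B^* ) is isomorphic to C^d: there are d cocycles whose classes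
   form a basis of the quotient space cocycles / coboundaries. *)
Definition HH_iso_Cd (n d : nat) : Prop :=
  exists f : 'I_d -> (nat -> B) -> B -> CC,
    [/\ (forall i, cocycle n (f i)),
        (forall g, cocycle n g -> exists c : 'I_d -> CC,
            coboundary n (fun b x => g b x - \sum_(i < d) c i * f i b x)) &
        (forall c : 'I_d -> CC,
            coboundary n (fun b x => \sum_(i < d) c i * f i b x) -> forall i, c i = 0)].

End Hochschild.

Definition HH_crossed (theta : Rdefinitions.R) (k n d : nat) : Prop :=
  @HH_iso_Cd (Alg k) (@badd k) (@bscale k) (@bmul theta k) n d.

(* Main.v *)
(* B is the twisted group algebra of G = Z^2 x| Gamma.  In the Weyl basis E_t a
   Hochschild n-cochain phi becomes the homogeneous cochain
     F(g_0,..,g_n)(x) = phi(E_{g_0}^-1 E_{g_1},..)(E_{g_n}^-1 E_x E_{g_0}),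
   which is equivariant under G up to a phase, and the Hochschild differential
   becomes the simplicial one.  Since Gamma is finite, a primitive equivariant
   under Z^2 may be averaged over Gamma, and the Z^2-complex splits over the
   Z^2-conjugacy classes of x = (v, g).  If g <> 1, Z^2 acts freely on the
   class and the complex is contractible.  If g = 1 and v <> 0, Z^2 acts on the
   coefficients by a character, nontrivial because theta is irrational, and the
   complex is again contractible.  At x = 1 one gets the cohomology of Z^2 with
   trivial coefficients: nothing above degree 2, the area class in degree 2, and
   in degree 1 no Gamma-invariants.  In degree 0 a trace is determined by its
   values on x = 1 and on the G-conjugacy classes over g <> 1; the phases along
   these classes are trivialised by a quadratic form at the fixed point of x. *)
Require Import Defs.
From mathcomp Require Import all_boot all_order all_algebra.
From mathcomp Require Import finmap.
From mathcomp Require Import boolp reals trigo complex Rstruct.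
From mathcomp Require Import ring zify.

Set Implicit Arguments.
Unset Strict Implicit.
Unset Printing Implicit Defensive.

Import Order.TTheory GRing.Theory Num.Theory.
Local Open Scope ring_scope.

(** * Homogeneous cochains *)

Section Simplicial.
Variables (X : Type) (R : comNzRingType).
Implicit Types (F K L : (nat -> X) -> R) (g h : nat -> X) (p : X).

Definition scons p g : nat -> X := fun j => if j is j'.+1 then g j' else p.
Definition shift g : nat -> X := fun j => g j.+1.

Definition dep n F := forall g g', (forall i, (i < n)%N -> g i = g' i) -> F g = F g'.

(** The index counts vertices, not degrees: by [dep_diff], functions of [n] vertices go to functions
    of [n.+1]. So the coboundary out of degree n is [diff n.+1], and [diff 0] is the
    augmentation. *)
Definition diff n F g : R :=
  \sum_(i < n.+1) (-1) ^+ i * F (fun j => g (bump i j)).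

Lemma diff0 F g : diff 0 F g = F (shift g).
Proof. by rewrite /diff big_ord_recl big_ord0 addr0 mul1r. Qed.

(** The face opposite the first vertex is split from the faces that keep it. The inductions on the
    number of vertices run on this recursion. *)
Lemma diffS n F g :
  diff n.+1 F g = F (shift g) - diff n (fun h => F (scons (g 0%N) h)) (shift g).
Proof.
rewrite /diff big_ord_recl mul1r; congr (_ + _).
rewrite -sumrN; apply: eq_bigr => i _.
rewrite exprS mulN1r mulNr; congr (- (_ * F _)); apply: funext => -[|j] //=.
by rewrite /shift; congr g; rewrite /bump /=; lia.
Qed.

Lemma diff_scons n F p g :
  diff n.+1 F (scons p g) = F g - diff n (fun h => F (scons p h)) g.
Proof. exact: diffS. Qed.

Lemma eq_diff n F F' : F =1 F' -> diff n F =1 diff n F'.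
Proof. by move=> e g; apply: eq_bigr => i _; rewrite e. Qed.

Lemma diffB n F F' g : diff n (fun h => F h - F' h) g = diff n F g - diff n F' g.
Proof.
by rewrite /diff -sumrB; apply: eq_bigr => i _; rewrite mulrBr.
Qed.

Lemma diffZ n c F g : diff n (fun h => c * F h) g = c * diff n F g.
Proof. by rewrite /diff mulr_sumr; apply: eq_bigr => i _; rewrite mulrCA. Qed.

Lemma diff_sum (I : finType) n (F : I -> (nat -> X) -> R) g :
  diff n (fun h => \sum_i F i h) g = \sum_i diff n (F i) g.
Proof.
by rewrite /diff exchange_big; apply: eq_bigr => i _; rewrite mulr_sumr.
Qed.

Lemma diff_comp n F (t : X -> X) g :
  diff n (fun h => F (fun j => t (h j))) g = diff n F (fun j => t (g j)).
Proof. by []. Qed.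

Lemma diffK n F g : diff n.+1 (diff n F) g = 0.
Proof.
elim: n F g => [|n IH] F g.
  by rewrite diffS !diff0 subrr.
rewrite diffS (@eq_diff n.+1 (fun h => diff n.+1 F (scons (g 0%N) h))
  (fun h => F h - diff n (fun h' => F (scons (g 0%N) h')) h)).
  by rewrite diffB IH subr0 subrr.
exact: diff_scons.
Qed.

Lemma dep_scons n F p : dep n.+1 F -> dep n (fun g => F (scons p g)).
Proof. by move=> dF g g' e; apply: dF => -[|i] //= /e. Qed.

Lemma dep_diff n F : dep n F -> dep n.+1 (diff n F).
Proof.
move=> dF g g' e; apply: eq_bigr => i _; congr (_ * _); apply: dF => j lj.
by apply: e; rewrite /bump; lia.
Qed.

Lemma dep_comp n F (t : X -> X) : dep n F -> dep n (fun g => F (fun j => t (g j))).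
Proof. by move=> dF g g' e; apply: dF => i /e ->. Qed.

Lemma dep_sub n F F' : dep n F -> dep n F' -> dep n (fun g => F g - F' g).
Proof. by move=> d d' g g' e; rewrite (d _ _ e) (d' _ _ e). Qed.

(** Coning from a fixed vertex contracts the complex as long as no equivariance is asked of the
    primitive. *)
Lemma cone_diff n F p : (forall g, diff n.+1 F g = 0) ->
  forall g, diff n (fun h => F (scons p h)) g = F g.
Proof.
by move=> dF g; have := dF (scons p g); rewrite diff_scons => /eqP; rewrite subr_eq0 => /eqP.
Qed.

(* [prism t n F] is the alternating sum of [F (g_0,..,g_i,t g_i,..,t g_(n-2))]
   over [i < n - 1], peeled off at its first vertex. *)
Fixpoint prism (t : X -> X) n F g : R :=
  if n is n'.+1 then
    if n' is 0 then 0
    else F (scons (g 0%N) (fun j => t (g j)))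
         - prism t n' (fun h => F (scons (g 0%N) h)) (shift g)
  else 0.

Lemma prismS t n F g : prism t n.+2 F g =
  F (scons (g 0%N) (fun j => t (g j)))
  - prism t n.+1 (fun h => F (scons (g 0%N) h)) (shift g).
Proof. by []. Qed.

Lemma eq_prism t n F F' : F =1 F' -> prism t n F =1 prism t n F'.
Proof. by move=> /funext ->. Qed.

Lemma prismB t n F F' g :
  prism t n (fun h => F h - F' h) g = prism t n F g - prism t n F' g.
Proof.
elim: n F F' g => [|[|n] IH] F F' g; rewrite ?subrr // !prismS IH.
by ring.
Qed.

(** The prism between a simplex and its image under [t] gives a chain homotopy from the identity to
    the map induced by [t]. *)
Lemma prism_homotopy t n F : dep n.+1 F -> forall g,
  diff n (prism t n.+1 F) g + prism t n.+2 (diff n.+1 F) g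
  = F (fun j => t (g j)) - F g.
Proof.
elim: n F => [|n IH] F dF g.
  rewrite diff0 prismS /= add0r subr0 diffS diff0; congr (F _ - _).
  by apply: dF => -[|i].
have dF0 : dep n.+1 (fun h => F (scons (g 0%N) h)) by apply: dep_scons.
have e := IH _ dF0 (shift g).
rewrite diffS [prism t n.+3 _ _]prismS.
have -> : diff n (fun h => prism t n.+2 F (scons (g 0%N) h)) (shift g)
  = diff n (fun h => F (scons (g 0%N) (scons (t (g 0%N)) (fun j => t (h j))))) (shift g)
    - diff n (prism t n.+1 (fun h => F (scons (g 0%N) h))) (shift g).
  rewrite -diffB; apply: eq_diff => h; rewrite prismS /=; congr (F _ - _).
  by apply: funext => -[|[|i]].
rewrite diff_scons [diff n.+1 _ _]diffS.
rewrite (@eq_prism _ _ (fun h => diff n.+2 F (scons (g 0%N) h))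
  (fun h => F h - diff n.+1 (fun h' => F (scons (g 0%N) h')) h)); last first.
  exact: diff_scons.
rewrite prismB.
have -> : F g = F (scons (g 0%N) (shift g)) by congr F; apply: funext => -[].
rewrite [diff n _ (shift (fun j => t (g j)))](_ : _ = diff n (fun h => F (scons (g 0%N)
   (scons (t (g 0%N)) (fun j => t (h j))))) (shift g)) //.
rewrite -[shift (fun j => t (g j))]/(fun j => t (shift g j)).
(* The bracket is the right side of the induction hypothesis [e], for the cochain with its first
   vertex frozen at [g 0]. *)
have -> : F (scons (g 0%N) (shift g)) = F (scons (g 0%N) (fun j => t (shift g j)))
  - (F (scons (g 0%N) (fun j => t (shift g j))) - F (scons (g 0%N) (shift g))) by ring.
rewrite -e /=; ring.
Qed.

Lemma prism0 t n g : prism t n (fun=> 0) g = 0.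
Proof.
rewrite -[RHS](subrr (prism t n (fun=> 0) g)) -prismB.
by congr prism; apply: funext => h; rewrite subrr.
Qed.

Lemma dep_prism t n F : dep n.+1 F -> dep n (prism t n.+1 F).
Proof.
elim: n F => [|n IH] F dF g g' e //.
rewrite !prismS e //; congr (_ - _).
  by apply: dF => -[|i] li //=; rewrite e.
by apply: IH => [|i li]; [apply: dep_scons | apply: e].
Qed.

(** This keeps the homotopy inside the equivariant complex when [t] and [s] are commuting
    translations. *)
Lemma prism_equivariant t (s : X -> X) c n F F' g :
    (forall p, t (s p) = s (t p)) -> (forall h, F (fun j => s (h j)) = c * F' h) ->
  prism t n F (fun j => s (g j)) = c * prism t n F' g.
Proof.
move=> tsC; elim: n F F' g => [|[|n] IH] F F' g e; rewrite ?mulr0 // !prismS mulrBr.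
congr (_ - _).
  by rewrite -e; congr F; apply: funext => -[|i] /=.
rewrite -[shift _]/(fun j => s (shift g j)); apply: IH => h.
by rewrite -e; congr F; apply: funext => -[|i].
Qed.
End Simplicial.

(** * Discrete integration and the cohomology of Z^2 with trivial coefficients *)

Section IntegerSum.
Variable R : zmodType.

(** The discrete integral from 0 to [m]: for negative [m] it is minus the sum over m <= i < 0, so
    that [zsumS] holds on all integers. *)
Definition zsum (f : int -> R) (m : int) : R :=
  match m with
  | Posz n => \sum_(i < n) f (Posz i)
  | Negz n => - \sum_(i < n.+1) f (Negz i)
  end.

Lemma zsumS f m : zsum f (m + 1) - zsum f m = f m.
Proof.
case: m => [n|[|n]].
- by rewrite -PoszD addn1 /= big_ord_recr /= addrAC subrr add0r.
- by rewrite /= big_ord0 sub0r opprK big_ord_recr big_ord0 /= add0r.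
- rewrite (_ : Negz n.+1 + 1 = Negz n) /=; last by rewrite !NegzE; lia.
  by rewrite [X in _ - (- X)]big_ord_recr /= opprK addrA addNr add0r.
Qed.
End IntegerSum.

Section Chase.
Variables (X : Type) (R : comNzRingType).
Implicit Types (F K L : (nat -> X) -> R) (g h : nat -> X) (p : X).

Definition invariant_under (t : X -> X) F := forall g, F (fun j => t (g j)) = F g.

(* On a free Z-set with equivariant height function [al], the operator
   [t - 1] on cochains is onto. *)
Section Integration.
Variables (t : int -> X -> X) (al : X -> int).
Hypothesis tD : forall m n p, t (m + n) p = t m (t n p).
Hypothesis alt : forall p, al (t 1 p) = al p + 1.

(** The sum of [L] over the translates of [g] whose first vertex runs from height 0 to just below
    its actual height; translating [g] by [t 1] adds the single term [L g]. *)
Definition primitive L g : R :=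
  zsum (fun i => L (fun j => t (i - al (g 0%N)) (g j))) (al (g 0%N)).

Hypothesis t0 : forall p, t 0 p = p.

Lemma primitiveE L g : primitive L (fun j => t 1 (g j)) - primitive L g = L g.
Proof.
rewrite /primitive alt.
have -> : (fun i => L (fun j => t (i - (al (g 0%N) + 1)) (t 1 (g j)))) =
          (fun i => L (fun j => t (i - al (g 0%N)) (g j))).
  apply: funext => i; congr L; apply: funext => j; rewrite -tD; congr (t _ _).
  by rewrite opprD addrA addrNK.
rewrite zsumS; congr L; apply: funext => j; by rewrite subrr t0.
Qed.

Lemma dep_primitive n L : dep n.+1 L -> dep n.+1 (primitive L).
Proof.
move=> dL g g' e; rewrite /primitive e //; congr zsum; apply: funext => i.
by apply: dL => j /e ->.
Qed.

Lemma primitive_invariant L (s : X -> X) :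
    (forall p, al (s p) = al p) -> (forall m p, t m (s p) = s (t m p)) ->
  invariant_under s L -> invariant_under s (primitive L).
Proof.
move=> als tsC sL g; rewrite /primitive als; congr zsum; apply: funext => i.
rewrite -[RHS]sL; congr L; apply: funext => j; exact: tsC.
Qed.
End Integration.

Variables (a b : int -> X -> X) (al be : X -> int) (p0 : X).
Hypotheses (aD : forall m n p, a (m + n) p = a m (a n p)) (a0 : forall p, a 0 p = p).
Hypotheses (bD : forall m n p, b (m + n) p = b m (b n p)) (b0 : forall p, b 0 p = p).
Hypotheses (ala : forall p, al (a 1 p) = al p + 1) (beb : forall p, be (b 1 p) = be p + 1).
Hypotheses (bea : forall p, be (a 1 p) = be p) (abC : forall m n p, a m (b n p) = b n (a m p)).

(** The defect of invariance of [K] is dL. Writing L = (t - 1)P with P = [primitive t ta L], the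
    cochain K - dP has no defect and the same coboundary as [K]. *)
Lemma correct_primitive n t ta F K L :
    (forall m n p, t (m + n) p = t m (t n p)) -> (forall p, t 0 p = p) ->
    (forall p, ta (t 1 p) = ta p + 1) ->
    dep n.+2 K -> dep n.+1 L -> (forall g, diff n.+2 K g = F g) ->
    (forall g, diff n.+1 L g = K (fun j => t 1 (g j)) - K g) ->
  let K' g := K g - diff n.+1 (primitive t ta L) g in
  [/\ dep n.+2 K', invariant_under (t 1) K' & forall g, diff n.+2 K' g = F g].
Proof.
move=> tD t0 tat dK dL KF LK K'; split.
- by apply: dep_sub => //; apply/dep_diff/dep_primitive.
- move=> g; rewrite /K'; apply/eqP; rewrite -subr_eq0; apply/eqP.
  have e : diff n.+1 (primitive t ta L) (fun j => t 1 (g j))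
           - diff n.+1 (primitive t ta L) g = diff n.+1 L g.
    by rewrite -diff_comp -diffB; apply: eq_diff => h; exact: primitiveE.
  have -> : K (fun j => t 1 (g j)) = K g + diff n.+1 L g by rewrite LK; ring.
  rewrite -e; ring.
- by move=> g; rewrite diffB KF diffK subr0.
Qed.

(** The vanishing of the cohomology of Z in degrees at least 2: one cone gives a primitive of [F], a
    second one a primitive of its defect of invariance, and [correct_primitive] applies. *)
Lemma chase_a n F : dep n.+3 F -> (forall g, diff n.+3 F g = 0) ->
    invariant_under (a 1) F ->
  exists K, [/\ dep n.+2 K, invariant_under (a 1) K & forall g, diff n.+2 K g = F g].
Proof.
move=> dF DF aF.
pose K1 g := F (scons p0 g).
have DK1 := cone_diff p0 DF.
have dK1 : dep n.+2 K1 := dep_scons p0 dF.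
pose L1 g := K1 (fun j => a 1 (g j)) - K1 g.
have DL1 g : diff n.+2 L1 g = 0.
  by rewrite diffB diff_comp !DK1 aF subrr.
have dL1 : dep n.+2 L1 by apply: dep_sub => //; apply: dep_comp.
eexists; exact: (correct_primitive aD a0 ala dK1 (dep_scons p0 dL1) DK1 (cone_diff p0 DL1)).
Qed.

(** Correction along [b] preserves invariance under [a 1], because [a 1] commutes with [b] and does
    not change the height [be]. *)
Lemma chase_b n F K L :
    dep n.+2 K -> dep n.+1 L -> (forall g, diff n.+2 K g = F g) ->
    (forall g, diff n.+1 L g = K (fun j => b 1 (g j)) - K g) ->
    invariant_under (a 1) K -> invariant_under (a 1) L ->
  exists K', [/\ dep n.+2 K', invariant_under (a 1) K', invariant_under (b 1) K'
               & forall g, diff n.+2 K' g = F g].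
Proof.
move=> dK dL KF LK aK aL.
have [d i e] := correct_primitive bD b0 beb dK dL KF LK.
eexists; split; [exact: d | | exact: i | exact: e].
move=> g; rewrite aK; congr (_ - _); rewrite -diff_comp; apply: eq_diff => h.
by apply: primitive_invariant => // m p; rewrite abC.
Qed.

(** The defect (b - 1)K of the [a]-invariant primitive is an [a]-invariant cocycle of degree at
    least 2, so [chase_a] gives it an [a]-invariant primitive. *)
Lemma chase_ge3 n F : dep n.+4 F -> (forall g, diff n.+4 F g = 0) ->
    invariant_under (a 1) F -> invariant_under (b 1) F ->
  exists K, [/\ dep n.+3 K, invariant_under (a 1) K, invariant_under (b 1) K
              & forall g, diff n.+3 K g = F g].
Proof.
move=> dF DF aF bF; have [K [dK aK KF]] := chase_a dF DF aF.
pose L1 g := K (fun j => b 1 (g j)) - K g.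
have DL1 g : diff n.+3 L1 g = 0.
  rewrite diffB (_ : diff _ (fun h => K (fun j => b 1 (h j))) g = F (fun j => b 1 (g j))).
    by rewrite bF KF subrr.
  exact: KF.
have dL1 : dep n.+3 L1 by apply: dep_sub => //; exact: (@dep_comp _ _ _ K (b 1) dK).
have aL1 : invariant_under (a 1) L1.
  move=> g; rewrite /L1 aK -[X in _ = X - _]aK; congr (K _ - _).
  by apply: funext => j; rewrite abC.
have [L [dL aL LL]] := chase_a dL1 DL1 aL1.
exact: chase_b dK dL KF LL aK aL.
Qed.

(* The pairing of a 2-cochain with the fundamental cycle of the torus. *)
Definition torus F : R :=
  F (scons p0 (scons (a 1 p0) (fun=> a 1 (b 1 p0))))
  - F (scons p0 (scons (b 1 p0) (fun=> a 1 (b 1 p0)))).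

(** Stokes on a square cut into two triangles: the diagonals cancel, and the four sides remain in
    opposite pairs, which cancel for invariant [K]. *)
Lemma torus_diff F K : dep 2 K ->
    (forall g, diff 2 K g = F g) ->
  torus F = K (scons p0 (fun=> a 1 p0)) - K (scons (b 1 p0) (fun=> b 1 (a 1 p0)))
          + (K (scons (a 1 p0) (fun=> a 1 (b 1 p0))) - K (scons p0 (fun=> b 1 p0))).
Proof.
move=> dK KF; rewrite /torus -!KF !diff_scons !diff0 /shift /=.
rewrite abC.
rewrite (dK (scons p0 (scons (a 1 p0) (fun=> b 1 (a 1 p0))))
  (scons p0 (fun=> a 1 p0))); last by case=> [|[]].
rewrite (dK (scons p0 (scons (b 1 p0) (fun=> b 1 (a 1 p0))))
  (scons p0 (fun=> b 1 p0))); last by case=> [|[]].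
ring.
Qed.

(** Here the defect (b - 1)K has degree 1, and its primitive [L] is [a]-invariant only up to a
    constant. The torus pairing computes this constant. *)
Lemma chase_2 F : dep 3 F -> (forall g, diff 3 F g = 0) ->
    invariant_under (a 1) F -> invariant_under (b 1) F -> torus F = 0 ->
  exists K, [/\ dep 2 K, invariant_under (a 1) K, invariant_under (b 1) K
              & forall g, diff 2 K g = F g].
Proof.
move=> dF DF aF bF tF; have [K [dK aK KF]] := chase_a dF DF aF.
pose L1 g := K (fun j => b 1 (g j)) - K g.
have DL1 g : diff 2 L1 g = 0.
  rewrite diffB (_ : diff _ (fun h => K (fun j => b 1 (h j))) g = F (fun j => b 1 (g j))).
    by rewrite bF KF subrr.
  exact: KF.
have dL1 : dep 2 L1 by apply: dep_sub => //; exact: (@dep_comp _ _ _ K (b 1) dK).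
have aL1 : invariant_under (a 1) L1.
  move=> g; rewrite /L1 aK -[X in _ = X - _]aK; congr (K _ - _).
  by apply: funext => j; rewrite abC.
have dL := dep_scons p0 dL1; set L := fun g => L1 _ in dL.
have DL : forall g, diff 1 L g = L1 g := cone_diff p0 DL1.
apply: (chase_b dK dL KF DL aK) => g.
pose M g := L (fun j => a 1 (g j)) - L g.
have DM h : diff 1 M h = 0 by rewrite diffB diff_comp !DL aL1 subrr.
have dM : dep 1 M by apply: dep_sub => //; exact: (@dep_comp _ _ _ L (a 1) dL).
(* A 0-cocycle is constant, so the base point alone has to be examined. *)
have M0 : M g = M (fun=> p0).
  have := DM (scons p0 g); rewrite diff_scons diff0 => /eqP; rewrite subr_eq0 => /eqP ->.
  by apply: dM => -[].
apply/eqP; rewrite -subr_eq0 -/(M g) M0; apply/eqP.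
(* The constant is minus the first pair of sides in [torus_diff]; the second pair vanishes since [K]
   is [a]-invariant. *)
have := torus_diff dK KF; rewrite tF => /esym tK.
have L10 : L1 (fun=> p0) = 0.
  have := DL1 (fun=> p0); rewrite !diffS diff0 /shift /= => /eqP.
  rewrite (_ : scons p0 (fun=> p0) = fun=> p0); last by apply: funext => -[].
  rewrite (_ : scons p0 (fun=> p0) = fun=> p0); last by apply: funext => -[].
  by rewrite subrr subr0 => /eqP.
rewrite /M /L (_ : scons p0 (fun=> p0) = fun=> p0) ?L10 ?subr0; last by apply: funext => -[].
rewrite /L1.
have -> : (fun j => b 1 (scons p0 (fun=> a 1 p0) j)) =
    scons (b 1 p0) (fun=> b 1 (a 1 p0)).
  by apply: funext => -[].
apply/eqP; rewrite subr_eq0; apply/eqP.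
move: tK; rewrite (_ : scons (a 1 p0) (fun=> a 1 (b 1 p0)) =
    (fun j => a 1 (scons p0 (fun=> b 1 p0) j))); last by apply: funext => -[].
by rewrite aK subrr addr0 => /eqP; rewrite subr_eq0 => /eqP.
Qed.

End Chase.

(** * Powers of lambda and the irrationality of theta *)

Section Lampow.
Variable theta : Rdefinitions.R.
Implicit Types s t : Rdefinitions.R.

Lemma lampowD s t : lampow theta (s + t) = lampow theta s * lampow theta t.
Proof.
rewrite /lampow mulrDr trigo.cosD trigo.sinD; apply/eqP; rewrite eq_complex /=.
by rewrite eqxx /=; apply/eqP; ring.
Qed.

Lemma lampow0 : lampow theta 0 = 1.
Proof. by rewrite /lampow mulr0 trigo.cos0 trigo.sin0. Qed.

Lemma lampow_neq0 s : lampow theta s != 0.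
Proof.
apply/eqP => e; have := lampowD s (- s).
by rewrite subrr lampow0 e mul0r => /eqP; rewrite oner_eq0.
Qed.

Lemma lampowN s : lampow theta (- s) = (lampow theta s)^-1.
Proof.
apply: (mulfI (lampow_neq0 s)); rewrite -lampowD subrr lampow0 divff //.
exact: lampow_neq0.
Qed.

Definition hlam (n : int) : CC := lampow theta (n%:~R / 2).

Lemma hlamD m n : hlam (m + n) = hlam m * hlam n.
Proof. by rewrite /hlam intrD mulrDl lampowD. Qed.

Lemma hlam0 : hlam 0 = 1.
Proof. by rewrite /hlam mul0r lampow0. Qed.

Lemma hlamN n : hlam (- n) = (hlam n)^-1.
Proof. by rewrite /hlam intrN mulNr lampowN. Qed.

Lemma hlam_neq0 n : hlam n != 0.
Proof. exact: lampow_neq0. Qed.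

(** By periodicity [r] may be replaced by its fractional part f. If f > 0 then sin(pi f) > 0,
    against cos(2 pi f) = 1 - 2 sin(pi f)^2. *)
Lemma cos2pi_eq1 (r : Rdefinitions.R) : cos (2 * pi * r) = 1 -> r = (Num.floor r)%:~R.
Proof.
move=> cr; pose f := r - (Num.floor r)%:~R.
have f_ge0 : 0 <= f by rewrite subr_ge0 floor_le_tmp.
have f_lt1 : f < 1 by rewrite ltrBlDl; have := floorD1_gt r; rewrite intrD.
have cos_per (m : int) (x : Rdefinitions.R) : cos (x + 2 * pi * m%:~R) = cos x.
  have nat_per (n : nat) (y : Rdefinitions.R) : cos (y + 2 * pi * n%:R) = cos y.
    elim: n y => [|n IH] y; first by rewrite mulr0 addr0.
    have -> : y + 2 * pi * n.+1%:R = y + 2 * pi * n%:R + pi *+ 2.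
      by rewrite -natr1; ring.
    by rewrite cosD2pi IH.
  case: m => n; first exact: nat_per.
  rewrite NegzE -(nat_per n.+1 (x + _)); congr cos.
  by rewrite intrN -[n.+1%:~R]/(n.+1%:R) mulrN addrNK.
have cf : cos (2 * pi * f) = 1.
  by rewrite -(cos_per (Num.floor r)) /f mulrBr addrNK.
have [f0|f_neq0] := eqVneq f 0.
  by apply/eqP; rewrite -subr_eq0 -/f f0.
have f_gt0 : 0 < f by rewrite lt0r f_neq0.
have s_gt0 : 0 < sin (pi * f).
  apply: sin_gt0_pi; rewrite mulr_gt0 ?pi_gt0 //=.
  by rewrite -[X in _ < X]mulr1 ltr_pM2l // pi_gt0.
have e : 2 * pi * f = (pi * f) *+ 2 by ring.
move: cf; rewrite e cos_mulr2n cos2sin2 => cf.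
have : sin (pi * f) ^+ 2 = 0.
  have : ((1 - sin (pi * f) ^+ 2) *+ 2 - 1 - 1 = 0 :> Rdefinitions.R) by rewrite cf subrr.
  rewrite (_ : _ - 1 - 1 = - 2 * sin (pi * f) ^+ 2); last by ring.
  by move/eqP; rewrite mulf_eq0 oppr_eq0 pnatr_eq0 /= => /eqP.
by move/eqP; rewrite expf_eq0 /= => /eqP s0; rewrite s0 ltxx in s_gt0.
Qed.

(** Irrationality enters here: lambda^n = 1 would make n theta an integer. *)
Lemma hlam_double_neq1 (n : int) : irrational theta -> n != 0 -> hlam (n + n) != 1.
Proof.
move=> irr n0; apply/eqP; rewrite /hlam.
have -> : (n + n)%:~R / 2 = n%:~R :> Rdefinitions.R by rewrite intrD; field.
case=> + _; rewrite -mulrA => /cos2pi_eq1; move: (Num.floor _) => m e.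
apply: irr; apply/rationalP.
have tn : theta = m%:~R / n%:~R by rewrite -e mulfK // intr_eq0.
case: n n0 tn {e} => n n0 tn; first by exists m, n.
by exists (- m), n.+1; rewrite tn NegzE !intrN invrN mulrN mulNr.
Qed.
End Lampow.

(** * The group Z^2 x| Gamma *)

Definition vec := (int * int)%type.

(** The symplectic form, with the sign that gives 1 on the exponents of U_2 and U_1, in agreement
    with U_2 U_1 = lambda U_1 U_2. *)
Definition om (v w : vec) : int := v.2 * w.1 - v.1 * w.2.

Lemma vec_eq (v w : vec) : v.1 = w.1 -> v.2 = w.2 -> v = w.
Proof. by case: v w => [? ?] [? ?] /= -> ->. Qed.

Lemma omDl u v w : om (u + v) w = om u w + om v w.
Proof. by rewrite /om /=; ring. Qed.
Lemma omDr u v w : om u (v + w) = om u v + om u w.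
Proof. by rewrite /om /=; ring. Qed.
Lemma omNl u v : om (- u) v = - om u v.
Proof. by rewrite /om /=; ring. Qed.
Lemma omNr u v : om u (- v) = - om u v.
Proof. by rewrite /om /=; ring. Qed.
Lemma om0l v : om 0 v = 0.
Proof. by rewrite /om /=; ring. Qed.
Lemma om0r v : om v 0 = 0.
Proof. by rewrite /om /=; ring. Qed.
Lemma omC u v : om u v = - om v u.
Proof. by rewrite /om /=; ring. Qed.
Lemma omvv v : om v v = 0.
Proof. by rewrite /om /=; ring. Qed.

Section Mx2.
Lemma mx2E (M : 'M[int]_2) : M = mx2 (M 0 0) (M 0 1) (M 1 0) (M 1 1).
Proof.
apply/matrixP => i j; rewrite mxE.
by case: i => [[|[|//]] li]; case: j => [[|[|//]] lj] /=; congr (M _ _); apply: val_inj.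
Qed.

Lemma mx2M a b c d a' b' c' d' : mx2 a b c d * mx2 a' b' c' d' =
  mx2 (a * a' + b * c') (a * b' + b * d') (c * a' + d * c') (c * b' + d * d').
Proof.
apply/matrixP => i j; rewrite !mxE !big_ord_recl big_ord0 !mxE /= addr0.
by case: i => [[|[|//]] li]; case: j => [[|[|//]] lj].
Qed.

Lemma mx2_1 : 1 = mx2 1 0 0 1.
Proof.
apply/matrixP => i j; rewrite !mxE.
by case: i => [[|[|//]] li]; case: j => [[|[|//]] lj].
Qed.

Definition det2 (M : 'M[int]_2) : int := M 0 0 * M 1 1 - M 0 1 * M 1 0.

Lemma det2_mx2 a b c d : det2 (mx2 a b c d) = a * d - b * c.
Proof. by rewrite /det2 !mxE. Qed.

Lemma det2M M N : det2 (M * N) = det2 M * det2 N.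
Proof. by rewrite [M]mx2E [N]mx2E mx2M !det2_mx2; ring. Qed.

Lemma act_vecM M N p q : act_vec (M * N) p q = act_vec M (act_vec N p q).1 (act_vec N p q).2.
Proof.
rewrite [M]mx2E [N]mx2E mx2M /act_vec !mxE /=.
by apply: vec_eq => /=; ring.
Qed.
End Mx2.

Section Group.
Variable k' : nat.
Notation k := k'.+1.
Notation T := (basis k).
Implicit Types (i j : 'I_k) (v w : vec) (s t x : T).

Definition act i v : vec := act_vec (gmat i) v.1 v.2.

Lemma actE i v : act i v =
  (gmat i 0 0 * v.1 + gmat i 0 1 * v.2, gmat i 1 0 * v.1 + gmat i 1 1 * v.2).
Proof. by []. Qed.

Lemma actD i v w : act i (v + w) = act i v + act i w.
Proof. by apply: vec_eq; rewrite /act /act_vec /=; ring. Qed.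

Lemma actN i v : act i (- v) = - act i v.
Proof. by apply: vec_eq; rewrite /act /act_vec /=; ring. Qed.

Lemma actv0 i : act i 0 = 0.
Proof. by apply: vec_eq; rewrite /act /act_vec /=; ring. Qed.

Lemma gmulE i j : gmul i j = i + j.
Proof. exact: val_inj. Qed.

Lemma act0v v : act 0 v = v.
Proof. by apply: vec_eq; rewrite /act /act_vec /gmat expr0 !mxE /=; ring. Qed.

Definition gm s t : T := (s.1 + act s.2 t.1, s.2 + t.2).
Definition gi t : T := (- act (- t.2) t.1, - t.2).
Definition g1 : T := (0, 0).

Lemma bmulT2E theta s t : (bmulT theta s t).2 = gm s t.
Proof. by case: s t => [[? ?] ?] [[? ?] ?]; rewrite /bmulT /= gmulE. Qed.

Hypothesis HK : k \in [:: 3; 4; 6]%N.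

Lemma gen_order : gen k ^+ k = 1.
Proof.
move: HK; rewrite !inE => /or3P[] /eqP [->];
by rewrite /gen /= !exprS expr0 mulr1 !mx2M mx2_1; congr mx2.
Qed.

Lemma det2_gmat i : det2 (gmat i) = 1.
Proof.
have d1 : det2 1 = 1 by rewrite /det2 !mxE.
have dg : det2 (gen k) = 1.
  by move: HK; rewrite !inE => /or3P[] /eqP [->]; rewrite /gen /= /det2 !mxE.
rewrite /gmat; elim: (nat_of_ord i) => [|n IH]; first by rewrite expr0.
by rewrite exprS det2M dg IH.
Qed.

Lemma actM i j v : act (i + j) v = act i (act j v).
Proof.
rewrite /act; have -> : gmat (i + j) = gmat i * gmat j.
  by rewrite /gmat -exprD /= (expr_mod _ gen_order).
exact: act_vecM.
Qed.

Lemma actNK i v : act (- i) (act i v) = v.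
Proof. by rewrite -actM addNr act0v. Qed.
Lemma actKN i v : act i (act (- i) v) = v.
Proof. by rewrite -actM subrr act0v. Qed.

Lemma om_act i v w : om (act i v) (act i w) = om v w.
Proof.
rewrite -[RHS]mul1r -(det2_gmat i) /det2 /om /act /act_vec /=; ring.
Qed.

Lemma actV i v : act (- i) v =
  (gmat i 1 1 * v.1 - gmat i 0 1 * v.2, gmat i 0 0 * v.2 - gmat i 1 0 * v.1).
Proof.
rewrite -[RHS](actNK i); congr act.
have e u : u = (gmat i 0 0 * gmat i 1 1 - gmat i 0 1 * gmat i 1 0) * u.
  by rewrite -/(det2 _) det2_gmat mul1r.
apply: vec_eq; rewrite /act /act_vec /= ; [rewrite [LHS]e | rewrite [LHS]e]; ring.
Qed.

(* [det (1 - M)] for a matrix [M] of determinant 1. *)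
Definition dt i : int := 2 - (gmat i 0 0 + gmat i 1 1).

(** A nontrivial element of Gamma fixes no nonzero vector; the powers of each generator are checked
    one by one. *)
Lemma dt_neq0 i : i != 0 -> dt i != 0.
Proof.
rewrite /dt /gmat -val_eqE /=; move: HK; rewrite !inE => /or3P[] /eqP ek;
have := ltn_ord i; move: (nat_of_ord i) => m; rewrite ek;
do 6?[case: m => [|m] //]; move=> _ _; rewrite /gen /= ?exprS ?expr0 ?mulr1 ?mx2M !mxE //=.
Qed.

(** In determinant 1 the adjugate of 1 - g is 1 - g^-1. In particular (1 - g)Z^2 contains det(1 - g)
    Z^2. *)
Lemma act_dt i v : (v - act i v) - act (- i) (v - act i v) = (dt i * v.1, dt i * v.2).
Proof.
rewrite !actD !actN actNK actV; apply: vec_eq; rewrite /dt /act /act_vec /=; ring.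
Qed.

Lemma gmA s t x : gm s (gm t x) = gm (gm s t) x.
Proof. by rewrite /gm /= actD actM !addrA. Qed.
Lemma g1m t : gm g1 t = t.
Proof. by rewrite /gm /= act0v !add0r; case: t. Qed.
Lemma gm1 t : gm t g1 = t.
Proof. by rewrite /gm /= actv0 !addr0; case: t. Qed.
Lemma giK t : gm (gi t) t = g1.
Proof. by rewrite /gm /= !addNr. Qed.
Lemma gKi t : gm t (gi t) = g1.
Proof. by rewrite /gm /= actN actKN !subrr. Qed.
Lemma gmK s t : gm (gi s) (gm s t) = t.
Proof. by rewrite gmA giK g1m. Qed.
Lemma gmKi s t : gm s (gm (gi s) t) = t.
Proof. by rewrite gmA gKi g1m. Qed.
Lemma giM s t : gi (gm s t) = gm (gi t) (gi s).
Proof.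
by rewrite -[RHS](gmK (gm s t)) -!gmA (gmA t) gKi g1m gKi gm1.
Qed.
Lemma gi1 : gi g1 = g1.
Proof. by rewrite -[LHS]g1m gKi. Qed.
Lemma giI t : gi (gi t) = t.
Proof. by rewrite -[LHS]gm1 -(giK t) gmK. Qed.
End Group.

(** * The crossed product in the Weyl basis *)

Section Algebra.
Variables (theta : Rdefinitions.R) (k' : nat).
Notation k := k'.+1.
Notation T := (basis k).
Notation B := (Alg k).
Notation hlam := (hlam theta).
Notation mul := (@bmul theta k).
Implicit Types (u v w : B) (s t x : T).

Lemma bscaleE a u t : bscale a u t = a * u t.
Proof.
by rewrite fsfunE; case: ifPn => // nu; rewrite (fsfun_dflt nu) mulr0.
Qed.

Lemma lcE a u v t : badd (bscale a u) v t = a * u t + v t.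
Proof.
rewrite fsfunE bscaleE inE; case: ifPn => // /norP [n1 n2].
by rewrite -bscaleE (fsfun_dflt n1) (fsfun_dflt n2) addr0.
Qed.

Lemma bscaleM a b u : bscale a (bscale b u) = bscale (a * b) u.
Proof. by apply/fsfunP => t; rewrite !bscaleE mulrA. Qed.

Lemma bscale1 u : bscale 1 u = u.
Proof. by apply/fsfunP => t; rewrite bscaleE mul1r. Qed.

(** Freedom in the summation sets lets elements with different supports be compared term by term, as
    bilinearity requires. *)
Lemma bmulE (A C : {fset T}) u v t :
    (finsupp u `<=` A)%fset -> (finsupp v `<=` C)%fset ->
  mul u v t = \sum_(t1 <- A) \sum_(t2 <- C)
    (if gm t1 t2 == t then (bmulT theta t1 t2).1 * u t1 * v t2 else 0).
Proof.
move=> uA vC.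
transitivity (\sum_(t1 <- finsupp u) \sum_(t2 <- finsupp v)
  (if gm t1 t2 == t then (bmulT theta t1 t2).1 * u t1 * v t2 else 0)).
  rewrite fsfunE; case: ifPn => [_|nt].
    by apply: eq_bigr => t1 _; apply: eq_bigr => t2 _; rewrite bmulT2E.
  rewrite big_seq big1 // => t1 h1; rewrite big_seq big1 // => t2 h2.
  case: eqP => // e; case/negP: nt; rewrite -e -(bmulT2E theta).
  by apply: in_imfset2.
rewrite (big_fset_incl _ uA); last first.
  move=> t1 _ n1; rewrite big1 // => t2 _.
  by rewrite (fsfun_dflt n1) mulr0 mul0r if_same.
apply: eq_bigr => t1 _; rewrite (big_fset_incl _ vC) // => t2 _ n2.
by rewrite (fsfun_dflt n2) mulr0 if_same.
Qed.

Lemma bmul_linl a u v w :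
  mul (badd (bscale a u) v) w = badd (bscale a (mul u w)) (mul v w).
Proof.
apply/fsfunP => t; rewrite lcE.
set x := badd _ _; pose A := (finsupp x `|` (finsupp u `|` finsupp v))%fset.
rewrite !(@bmulE A (finsupp w)) ?fsubset_refl ?fsubsetUl //;
  try by rewrite /A fsetUCA fsubsetUl.
  by rewrite mulr_sumr -big_split; apply: eq_bigr => t1 _; rewrite mulr_sumr -big_split;
    apply: eq_bigr => t2 _; rewrite /= lcE; case: ifP => _; ring.
by rewrite /A fsetUA fsubsetUr.
Qed.

Lemma bmul_linr a u v w :
  mul w (badd (bscale a u) v) = badd (bscale a (mul w u)) (mul w v).
Proof.
apply/fsfunP => t; rewrite lcE.
set x := badd _ _; pose A := (finsupp x `|` (finsupp u `|` finsupp v))%fset.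
rewrite !(@bmulE (finsupp w) A) ?fsubset_refl ?fsubsetUl //;
  try by rewrite /A fsetUCA fsubsetUl.
  by rewrite mulr_sumr -big_split; apply: eq_bigr => t1 _; rewrite mulr_sumr -big_split;
    apply: eq_bigr => t2 _; rewrite /= lcE; case: ifP => _; ring.
by rewrite /A fsetUA fsubsetUr.
Qed.

Definition bzero : B := bscale 0 [fsfun].

Lemma badd0 u : badd u bzero = u.
Proof.
have -> : u = bscale 1 u by rewrite bscale1.
by apply/fsfunP => t; rewrite lcE bscaleE [bzero t]bscaleE mul0r addr0.
Qed.

Lemma bmulZl a u w : mul (bscale a u) w = bscale a (mul u w).
Proof.
have z : mul bzero w = bzero.
  have := bmul_linl (-1) bzero bzero w.
  rewrite (_ : badd (bscale (-1) bzero) bzero = bzero) => [->|].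
    by apply/fsfunP => t; rewrite lcE mulN1r addNr bscaleE mul0r.
  by apply/fsfunP => t; rewrite lcE !bscaleE !mul0r mulr0 addr0.
by rewrite -[bscale a u]badd0 bmul_linl z badd0.
Qed.

Lemma bmulZr a u w : mul w (bscale a u) = bscale a (mul w u).
Proof.
have z : mul w bzero = bzero.
  have := bmul_linr (-1) bzero bzero w.
  rewrite (_ : badd (bscale (-1) bzero) bzero = bzero) => [->|].
    by apply/fsfunP => t; rewrite lcE mulN1r addNr bscaleE mul0r.
  by apply/fsfunP => t; rewrite lcE !bscaleE !mul0r mulr0 addr0.
by rewrite -[bscale a u]badd0 bmul_linr z badd0.
Qed.

(* The Weyl basis [lambda^(pq/2) U1^p U2^q (x) g]: in it the structure
   constants are expressed through the symplectic form. *)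
Definition wt t : CC := hlam (t.1.1 * t.1.2).
Definition E t : B := [fsfun x in [fset t]%fset => wt t].

Lemma wt_neq0 t : wt t != 0.
Proof. exact: hlam_neq0. Qed.

Lemma EE t x : E t x = if x == t then wt t else 0.
Proof. by rewrite fsfunE inE. Qed.

Lemma finsuppE t : (finsupp (E t) `<=` [fset t])%fset.
Proof.
apply/fsubsetP => x; rewrite mem_finsupp EE inE; case: ifP => // _; by case/eqP.
Qed.

Definition mu s t : CC := hlam (om s.1 (act s.2 t.1)).

Lemma mu_neq0 s t : mu s t != 0.
Proof. exact: hlam_neq0. Qed.

Lemma bmul_E s t : mul (E s) (E t) = bscale (mu s t) (E (gm s t)).
Proof.
apply/fsfunP => x; rewrite (bmulE _ (@finsuppE s) (@finsuppE t)).
rewrite !big_seq_fset1 bscaleE !EE !eqxx [x == _]eq_sym; case: eqP => _; last by rewrite mulr0.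
rewrite /mu /wt; case: s t => [[p1 q1] g] [[p2 q2] h] /=.
rewrite /act_coef /hlam /act /=.
rewrite -!lampowD; congr (lampow theta _); rewrite /om /act_vec /= !(intrD, intrM, intrN); by field.
Qed.
End Algebra.

(** * Multilinear cochains *)

Section Cochains.
Variables (theta : Rdefinitions.R) (k' : nat).
Notation k := k'.+1.
Notation T := (basis k).
Notation B := (Alg k).
Notation mul := (@bmul theta k).
Notation E := (@E theta k').
Notation wt := (@wt theta k').
Notation chain n phi := (@cochain B (@badd k) (@bscale k) n phi).
Notation delta := (@hdelta B mul).
Implicit Types (u v w x : B) (b : nat -> B).

Definition lin (L : B -> CC) :=
  forall a u v, L (badd (bscale a u) v) = a * L u + L v.

Lemma lin0 L : lin L -> L (bzero k') = 0.
Proof.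
move=> lL; have := lL (-1) (bzero k') (bzero k').
rewrite mulN1r addNr => <-; congr L.
by apply/fsfunP => t; rewrite lcE !bscaleE !mul0r mulr0 addr0.
Qed.

Lemma linZ L a u : lin L -> L (bscale a u) = a * L u.
Proof. by move=> lL; rewrite -[bscale a u]badd0 lL lin0 // addr0. Qed.

Lemma lin_eq0 L : lin L -> (forall t : T, L (E t) = 0) -> forall u, L u = 0.
Proof.
move=> lL LE u.
suff H (A : {fset T}) : L [fsfun t in A => u t] = 0.
  rewrite -(H (finsupp u)); congr L; apply/fsfunP => t; rewrite fsfunE.
  by case: ifPn => // /fsfun_dflt.
elim/fset1U_rect: A => [|t A tA IH].
  rewrite -[RHS](lin0 lL); congr L; apply/fsfunP => t.
  by rewrite bscaleE mul0r fsfunE inE.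
have -> : [fsfun s in (t |` A)%fset => u s] =
    badd (bscale (u t / wt t) (E t)) [fsfun s in A => u s] :> B.
  apply/fsfunP => s; rewrite lcE EE !fsfunE !inE.
  case: (eqVneq s t) => [->|] /=.
    by rewrite (negPf tA) divfK ?wt_neq0 // addr0.
  by rewrite mulr0 add0r.
by rewrite lL LE IH mulr0 addr0.
Qed.

(** The quotient [u t / wt t] is the coordinate of [u] on the Weyl element [E t]. *)
Definition lext (f : T -> CC) u : CC := \sum_(t <- finsupp u) (u t / wt t) * f t.

Lemma lextE (A : {fset T}) f u : (finsupp u `<=` A)%fset ->
  lext f u = \sum_(t <- A) (u t / wt t) * f t.
Proof.
move=> uA; rewrite /lext (big_fset_incl _ uA) // => t _ /fsfun_dflt ->.
by rewrite !mul0r.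
Qed.

Lemma lin_lext f : lin (lext f).
Proof.
move=> a u v; set x := badd _ _; pose A := (finsupp x `|` (finsupp u `|` finsupp v))%fset.
rewrite !(@lextE A) ?fsubsetUl //; try by rewrite /A fsetUCA fsubsetUl.
  by rewrite mulr_sumr -big_split; apply: eq_bigr => t _; rewrite /= lcE; ring.
by rewrite /A fsetUA fsubsetUr.
Qed.

Lemma lext_E f t : lext f (E t) = f t.
Proof.
by rewrite (lextE _ (@finsuppE _ _ t)) big_seq_fset1 EE eqxx divff ?wt_neq0 // mul1r.
Qed.

Lemma lin_sum (L : T -> B -> CC) u : (forall t, lin (L t)) ->
  lin (fun v => lext (fun t => L t v) u).
Proof.
move=> lL a v w; rewrite /lext mulr_sumr -big_split; apply: eq_bigr => t _ /=.
by rewrite lL; ring.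
Qed.

Lemma upd_id b i : upd b i (b i) = b.
Proof. by apply: funext => j; rewrite /upd; case: eqP => // ->. Qed.

Section Cochain.
Variables (n : nat) (phi : (nat -> B) -> B -> CC).
Hypothesis cphi : chain n phi.

Lemma cochain_dep b b' x : (forall i, (i < n)%N -> b i = b' i) -> phi b x = phi b' x.
Proof. by case: cphi => d _ _ e; apply: d. Qed.

Lemma cochain_lin b : lin (phi b).
Proof. by case: cphi => _ _ l a u v; apply: l. Qed.

Lemma cochain_slot b i x : (i < n)%N -> lin (fun u => phi (upd b i u) x).
Proof. by case: cphi => _ m _ li a u v; apply: m. Qed.

Lemma cochain_scale (r : nat -> CC) b x :
  phi (fun j => bscale (r j) (b j)) x = (\prod_(j < n) r j) * phi b x.
Proof.
suff H m : (m <= n)%N ->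
    phi (fun j => if (j < m)%N then bscale (r j) (b j) else b j) x
    = (\prod_(j < m) r j) * phi b x.
  by rewrite -(H n (leqnn n)); apply: cochain_dep => i ->.
elim: m => [_|m IH lm]; first by rewrite big_ord0 mul1r.
set b' := fun j => _.
rewrite -[b'](upd_id b' m) {2}/b' ltnSn (linZ _ _ (cochain_slot b' x lm)).
rewrite big_ord_recr /= [\prod_(_ < _) _ * _]mulrC -mulrA -IH; last exact: ltnW.
congr (_ * _); congr phi; apply: funext => j; rewrite /upd /b' ltnS leq_eqVlt.
by case: eqP => [->|] //=; rewrite ltnn.
Qed.

Lemma cochain_eq0 :
    (forall (t : nat -> T) y, phi (fun j => E (t j)) (E y) = 0) -> forall b x, phi b x = 0.
Proof.
move=> phi0 b; apply: lin_eq0; first exact: cochain_lin.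
move=> y.
(* The slots from [m] on already hold Weyl elements and the earlier ones are arbitrary; linearity in
   one slot at a time raises [m] from 0 to [n]. *)
suff H m b' : (m <= n)%N -> (forall j, (m <= j < n)%N -> exists t, b' j = E t) ->
    phi b' (E y) = 0 by apply: (H n b) => // j; lia.
elim: m b' => [|m IH] b' lm tb.
  have /choice [t bt] : forall j, exists t, (j < n)%N -> b' j = E t.
    by move=> j; case: (ltnP j n) => [lj|_]; [have [t ->] := tb j lj; exists t | exists (g1 k')].
  by rewrite -(phi0 t y); apply: cochain_dep => i /bt.
rewrite -(upd_id b' m).
apply: (lin_eq0 (cochain_slot b' (E y) lm)) => t.
apply: IH; first exact: ltnW.
move=> j lj; rewrite /upd; case: eqP => [_|nj]; first by exists t.
by apply: tb; lia.
Qed.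
End Cochain.

Lemma cochain_comb n (I : finType) (c : I -> CC) (f : I -> (nat -> B) -> B -> CC) g :
    (forall i, chain n (f i)) -> chain n g ->
  chain n (fun b x => g b x - \sum_i c i * f i b x).
Proof.
move=> cf cg; split.
- move=> b b' e x; rewrite (cochain_dep cg x e); congr (_ - _); apply: eq_bigr => i _.
  by rewrite (cochain_dep (cf i) x e).
- move=> b i li a u v x; rewrite (cochain_slot cg b x li) mulrBr mulr_sumr.
  rewrite addrACA -opprD -big_split /=; congr (_ - _); apply: eq_bigr => j _.
  by rewrite (cochain_slot (cf j) b x li); ring.
- move=> b a u v; rewrite (cochain_lin cg b) mulrBr mulr_sumr.
  rewrite addrACA -opprD -big_split /=; congr (_ - _); apply: eq_bigr => j _.
  by rewrite (cochain_lin (cf j) b); ring.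
Qed.

Lemma contract_upd_lt b i j u : (i < j)%N ->
  contract mul (upd b i u) j = upd (contract mul b j) i u.
Proof.
move=> lij; apply: funext => l; rewrite /contract /upd.
have [->|nl] := eqVneq l i; first by rewrite lij.
do 2?case: ifP => //; last by move=> _; case: eqP => //; lia.
by move=> /eqP -> _; rewrite !gtn_eqF // ltnS ltnW.
Qed.

Lemma contract_updl b j u :
  contract mul (upd b j u) j = upd (contract mul b j) j (mul u (b j.+1)).
Proof.
apply: funext => l; rewrite /contract /upd.
have [->|nl] := eqVneq l j; first by rewrite ltnn eqxx gtn_eqF.
by case: ifP => // ll; rewrite gtn_eqF //; lia.
Qed.

Lemma contract_updr b j u :
  contract mul (upd b j.+1 u) j = upd (contract mul b j) j (mul (b j) u).
Proof.
apply: funext => l; rewrite /contract /upd.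
have [->|nl] := eqVneq l j; first by rewrite ltnn eqxx ltn_eqF.
by case: ifP => // ll; case: eqP => // e; lia.
Qed.

Lemma contract_upd_gt b i j u : (j < i)%N ->
  contract mul (upd b i.+1 u) j = upd (contract mul b j) i u.
Proof.
move=> lij; apply: funext => l; rewrite /contract /upd eqSS.
have [->|nl] := eqVneq l i.
  by rewrite ltnNge (ltnW lij) /= gtn_eqF // eqxx.
case lj: (l < j)%N; first by rewrite ltn_eqF //; lia.
rewrite eqSS (negPf nl) (ltn_eqF lij) (@ltn_eqF j i.+1) //; exact: ltnW.
Qed.

(** In each face a given slot survives, possibly renumbered, or becomes a factor of a product, which
    is bilinear. In the outer faces the product sits in the evaluation point. *)
Lemma hdelta_cochain n phi : chain n phi -> chain n.+1 (delta n phi).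
Proof.
move=> cphi; have dphi := cochain_dep cphi; have lphi := cochain_lin cphi.
have sphi := cochain_slot cphi; split.
- move=> b b' e x; rewrite /hdelta (e 0%N) // (e n) //.
  congr (_ + _ + _).
  + by apply: dphi => i li; apply: e.
  + apply: eq_bigr => i _; congr (_ * _); apply: dphi => j lj.
    by rewrite /contract !e //; have := ltn_ord i; lia.
  + by congr (_ * _); apply: dphi => j lj; apply: e; lia.
- move=> b i li a u v x.
  have h0 : lin (fun u => phi (fun j => upd b i u j.+1) (mul x (upd b i u 0%N))).
    case: i li => [_|i li] {}a {}u {}v.
      rewrite /upd /= bmul_linr; exact: lphi.
    exact: (sphi (fun j => b j.+1) i _ li).
  have hm (j : 'I_n) : lin (fun u => phi (contract mul (upd b i u) j) x).
    move=> {}a {}u {}v; have lj := ltn_ord j.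
    have [lt|gt|eq] := ltngtP i j.
    + rewrite !contract_upd_lt //; apply: sphi; lia.
    + case: i gt li {h0} => [//|i] gt li; move: gt; rewrite ltnS leq_eqVlt => /orP[/eqP <-|gt].
        by rewrite !contract_updr bmul_linr; apply: sphi.
      by rewrite !contract_upd_gt //; apply: sphi.
    + by rewrite eq !contract_updl bmul_linl; apply: sphi.
  have hn : lin (fun u => phi (upd b i u) (mul (upd b i u n) x)).
    move=> {}a {}u {}v; move: li; rewrite ltnS leq_eqVlt => /orP[/eqP ->|li].
      have e w : phi (upd b n w) = phi b.
        by apply: funext => y; apply: dphi => j lj; rewrite /upd ltn_eqF.
      by rewrite !e /upd eqxx bmul_linl lphi.
    by rewrite /upd gtn_eqF // -/(upd b i _); apply: sphi.
  rewrite /hdelta h0 hn.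
  under eq_bigr do rewrite hm.
  rewrite !mulrDr mulr_sumr.
  under eq_bigr do rewrite mulrDr.
  rewrite big_split /=; under [X in _ + (X + _) + _]eq_bigr do rewrite mulrCA.
  ring.
- move=> b a u v; rewrite /hdelta bmul_linl bmul_linr !lphi.
  under eq_bigr do rewrite lphi.
  rewrite !mulrDr mulr_sumr.
  under eq_bigr do rewrite mulrDr.
  rewrite big_split /=; under [X in _ + (X + _) + _]eq_bigr do rewrite mulrCA.
  ring.
Qed.

(** Entries beyond the first [n] are set to the identity, so [c] is recovered in [ext_E] when it
    depends on the first [n] alone. *)
Fixpoint ext n (c : (nat -> T) -> T -> CC) b x : CC :=
  if n is n'.+1 then
    lext (fun t => ext n' (fun s => c (scons t s)) (fun j => b j.+1) x) (b 0%N)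
  else lext (c (fun=> g1 k')) x.

Lemma ext_cochain n c : chain n (ext n c).
Proof.
elim: n c => [|n IH] c.
  by split=> // b a u v; rewrite /= lin_lext.
split=> /=.
- move=> b b' e x; rewrite (e 0%N) //; congr lext; apply: funext => t.
  by apply: (cochain_dep (IH _)) => i li; apply: e.
- move=> b [|i] li a u v x; first by rewrite /upd /= lin_lext.
  apply: (lin_sum (L := fun t w => ext n (fun s => c (scons t s)) (fun j => upd b i.+1 w j.+1) x)).
  by move=> t; apply: (cochain_slot (IH _)).
- move=> b a u v.
  apply: (lin_sum (L := fun t w => ext n (fun s => c (scons t s)) (fun j => b j.+1) w)).
  by move=> t; apply: (cochain_lin (IH _)).
Qed.

Lemma ext_E n c t y :
    (forall s s', (forall i, (i < n)%N -> s i = s' i) -> c s y = c s' y) ->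
  ext n c (fun j => E (t j)) (E y) = c t y.
Proof.
elim: n c t => [|n IH] c t dc /=; first by rewrite lext_E; apply: dc.
rewrite lext_E IH; last by move=> s s' e; apply: dc => -[|i] //= /e.
by apply: dc => -[].
Qed.
End Cochains.

(** * Hochschild cochains as equivariant homogeneous cochains *)

Section Homogeneous.
Variables (theta : Rdefinitions.R) (k' : nat).
Notation k := k'.+1.
Hypothesis HK : k \in [:: 3; 4; 6]%N.
Notation T := (basis k).
Notation B := (Alg k).
Notation mul := (@bmul theta k).
Notation E := (@E theta k').
Notation mu := (@mu theta k').
Notation chain n phi := (@cochain B (@badd k) (@bscale k) n phi).
Notation delta := (@hdelta B mul).
Implicit Types (u v w : B) (g : nat -> T) (h l x y : T).

(** The structure constants form a 2-cocycle on G because Gamma preserves [om]. *)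
Lemma mu_cocycle (a b c : T) : mu a b * mu (gm a b) c = mu b c * mu a (gm b c).
Proof.
rewrite /mu -!hlamD; congr (hlam _ _); rewrite /gm /= actM // actD omDl omDr om_act //.
ring.
Qed.

Lemma mu1l t : mu (g1 k') t = 1.
Proof. by rewrite /mu /= om0l hlam0. Qed.
Lemma muV t : mu t (gi t) = 1.
Proof. by rewrite /mu /= actN actKN // omNr omvv oppr0 hlam0. Qed.
Lemma muVV s t : mu (gi t) (gi s) = (mu s t)^-1.
Proof.
rewrite /mu -hlamN; congr (hlam _ _); rewrite /= actN omNl omNr opprK.
by rewrite om_act // [om s.1 _]omC opprK -[LHS](om_act HK s.2) actKN.
Qed.

(** The edges of a homogeneous simplex are of this kind, and on such elements associativity is
    [mu_cocycle]. *)
Definition mono u := exists c t, u = bscale c (E t).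

Lemma mono_E t : mono (E t).
Proof. by exists 1, t; rewrite bscale1. Qed.

Lemma mono_mul u v : mono u -> mono v -> mono (mul u v).
Proof.
move=> [c [s ->]] [d [t ->]]; exists (c * d * mu s t), (gm s t).
by rewrite bmulZl bmulZr bmul_E !bscaleM.
Qed.

Lemma mono_mulA u v w : mono u -> mono v -> mono w ->
  mul u (mul v w) = mul (mul u v) w.
Proof.
move=> [a [s ->]] [b [t ->]] [c [r ->]].
rewrite !(bmulZl, bmulZr, bmul_E, bscaleM) gmA //; congr bscale.
rewrite (_ : _ * mu s _ = a * b * c * (mu t r * mu s (gm t r))); last by ring.
by rewrite -mu_cocycle; ring.
Qed.

Lemma mono_mul1 u : mono u -> mul (E (g1 k')) u = u.
Proof. by move=> [c [t ->]]; rewrite bmulZr bmul_E mu1l g1m bscale1. Qed.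

(** By [muV], [E (gi g)] is the exact inverse of [E g]. Thus [W] is an edge E_g^-1 E_h and [Y] the
    edge twisted by [x] that closes the simplex; multiplying consecutive edges deletes their common
    vertex without a phase. *)
Definition W (g h : T) := mul (E (gi g)) (E h).
Definition Y (g x h : T) := mul (mul (E (gi g)) (E x)) (E h).

Local Hint Resolve mono_E mono_mul : core.

Lemma mulEV h : mul (E h) (E (gi h)) = E (g1 k').
Proof. by rewrite bmul_E muV gKi // bscale1. Qed.

Lemma mul_cancel u v h : mono u -> mono v ->
  mul (mul u (E h)) (mul (E (gi h)) v) = mul u v.
Proof.
move=> mu_ mv; rewrite -mono_mulA; auto.
by rewrite [mul (E h) _]mono_mulA ?mulEV ?mono_mul1; auto.
Qed.

Lemma W_mul (g : T) h l : mul (W g h) (W h l) = W g l.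
Proof. exact: mul_cancel. Qed.
Lemma YW_mul (g : T) x h l : mul (Y g x h) (W h l) = Y g x l.
Proof. apply: mul_cancel; auto. Qed.
Lemma WY_mul (g : T) x h l : mul (W h g) (Y g x l) = Y h x l.
Proof.
by rewrite /W /Y -[mul (mul (E (gi g)) _) _]mono_mulA // mul_cancel ?mono_mulA; auto.
Qed.

Lemma WE (g : T) h : W g h = bscale (mu (gi g) h) (E (gm (gi g) h)).
Proof. exact: bmul_E. Qed.

Lemma YE (g : T) x h :
  Y g x h = bscale (mu (gi g) x * mu (gm (gi g) x) h) (E (gm (gm (gi g) x) h)).
Proof. by rewrite /Y bmul_E bmulZl bmul_E bscaleM. Qed.

Definition gconj h x : T := gm (gm (gi h) x) h.
(** The exponent, in powers of lambda^(1/2), of the phase in E_h^-1 E_x E_h; it sees [h] through its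
    translation part alone. *)
Definition ee (w : vec) x : int := om x.1 w + om x.1 (act x.2 w) - om w (act x.2 w).
Definition chi h x : CC := hlam theta (ee h.1 x).

Lemma Y_conj h x : Y h x h = bscale (chi h x) (E (gconj h x)).
Proof.
rewrite YE; congr bscale; rewrite /mu -hlamD; congr (hlam _ _).
rewrite /gm /= actM // -[- act _ _]actN -actD !om_act // /ee omDl !omNl.
by rewrite (omC h.1 x.1); ring.
Qed.

Lemma E_gm h l : E (gm h l) = bscale (mu h l)^-1 (mul (E h) (E l)).
Proof. by rewrite bmul_E bscaleM mulVf ?bscale1 // mu_neq0. Qed.

Lemma E_gi_gm h (g : T) : E (gi (gm h g)) = bscale (mu h g) (mul (E (gi g)) (E (gi h))).
Proof.
by rewrite giM // E_gm muVV invrK.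
Qed.

Lemma mul_cancelV u v h : mono u -> mono v ->
  mul (mul u (E (gi h))) (mul (E h) v) = mul u v.
Proof.
by move=> m1 m2; have := mul_cancel (gi h) m1 m2; rewrite giI.
Qed.

Lemma W_gm h (g : T) l : W (gm h g) (gm h l) = bscale (mu h g / mu h l) (W g l).
Proof.
by rewrite /W E_gi_gm E_gm bmulZl bmulZr bscaleM mul_cancelV; auto.
Qed.

Lemma Y_gm h (g : T) x l : Y (gm h g) x (gm h l)
  = bscale (mu h g / mu h l * chi h x) (Y g (gconj h x) l).
Proof.
have e : mul (mul (mul (E (gi g)) (E (gi h))) (E x)) (mul (E h) (E l))
       = mul (mul (E (gi g)) (Y h x h)) (E l).
  by rewrite /Y !mono_mulA; auto.
rewrite {1}/Y E_gi_gm E_gm !bmulZl bmulZr e Y_conj bmulZr bmulZl !bscaleM /Y.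
by congr bscale; ring.
Qed.

Definition homc n (phi : (nat -> B) -> B -> CC) g x : CC :=
  phi (fun j => W (g j) (g j.+1)) (Y (g n) x (g 0%N)).

Definition gequiv (F : (nat -> T) -> T -> CC) :=
  forall h g x, F (fun j => gm h (g j)) x = chi h x * F g (gconj h x).

Definition homog n (F : (nat -> T) -> T -> CC) := forall x, dep n (fun g => F g x).

Lemma hom_dep n phi : chain n phi -> homog n.+1 (homc n phi).
Proof.
move=> cphi x g g' e; rewrite /homc (e 0%N (ltn0Sn _)) (e n (ltnSn _)).
by apply: (cochain_dep cphi) => i li; rewrite !e // ltnW.
Qed.

Lemma hom_equiv n phi : chain n phi -> gequiv (homc n phi).
Proof.
move=> cphi h g x; rewrite /homc Y_gm (linZ _ _ (cochain_lin cphi _)).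
rewrite (_ : (fun j => _) = (fun j => bscale (mu h (g j) / mu h (g j.+1)) (W (g j) (g j.+1)))).
  rewrite (cochain_scale cphi (fun j => mu h (g j) / mu h (g j.+1))).
  (* The phases of the edges telescope and are undone by the phase of the closing edge, which leaves
     [chi]. *)
  have -> : \prod_(j < n) (mu h (g j) / mu h (g j.+1)) = mu h (g 0%N) / mu h (g n).
    elim: n {cphi} => [|n IH]; first by rewrite big_ord0 divff ?mu_neq0.
    by rewrite big_ord_recr /= IH mulrA divfK ?mu_neq0.
  by field; rewrite !mu_neq0.
by apply: funext => j; rewrite W_gm.
Qed.

(** The first and last Hochschild terms merge the closing edge with a neighbour and so delete vertex
    0 and vertex n + 1; the inner terms delete the inner vertices. *)
Lemma hom_delta n phi g x : chain n phi ->
  homc n.+1 (delta n phi) g x = diff n.+1 (fun g' => homc n phi g' x) g.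
Proof.
move=> cphi; rewrite /diff big_ord_recl big_ord_recr /= /homc /hdelta mul1r.
rewrite YW_mul WY_mul addrA; apply: (f_equal2 +%R); last first.
  rewrite (_ : bump (bump 0 n) n = n); last by rewrite /bump /=; lia.
  congr (_ * _); apply: (cochain_dep cphi) => j lj.
  by congr (W (g _) (g _)); rewrite /bump /=; lia.
apply: (f_equal2 +%R); first by [].
apply: eq_bigr => i _; congr (_ * _).
rewrite (_ : bump (bump 0 i) n = n.+1); last by rewrite /bump /=; have := ltn_ord i; lia.
congr phi; apply: funext => j; rewrite /contract.
have [lji|lij|->] := ltngtP j i.
- by congr (W (g _) (g _)); rewrite /bump /=; lia.
- by congr (W (g _) (g _)); rewrite /bump /=; lia.
- rewrite W_mul; congr (W (g _) (g _)); rewrite /bump /=; lia.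
Qed.

(** The vertices of the simplex that starts at the identity and has edges t_0, t_1, and so on. *)
Fixpoint pp (t : nat -> T) j : T := if j is j'.+1 then gm (pp t j') (t j') else g1 k'.

Definition scal n t x : CC := (\prod_(j < n) mu (gi (pp t j)) (pp t j.+1)) *
  (mu (gi (pp t n)) x * mu (gm (gi (pp t n)) x) (g1 k')).

Lemma scal_neq0 n t x : scal n t x != 0.
Proof.
rewrite /scal !mulf_neq0 ?mu_neq0 //; apply/prodf_neq0 => i _; exact: mu_neq0.
Qed.

Lemma hom_pp n phi t x : chain n phi -> homc n phi (pp t) x =
  scal n t x * phi (fun j => E (t j)) (E (gm (gi (pp t n)) x)).
Proof.
move=> cphi; rewrite /homc YE gm1 (linZ _ _ (cochain_lin cphi _)).
rewrite (_ : (fun j => _) = (fun j => bscale (mu (gi (pp t j)) (pp t j.+1)) (E (t j)))).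
  by rewrite (cochain_scale cphi (fun j => mu (gi (pp t j)) (pp t j.+1))) /scal; ring.
by apply: funext => j; rewrite WE /= gmK.
Qed.

Lemma hom_inj n phi : chain n phi -> (forall g x, homc n phi g x = 0) ->
  forall b (x : B), phi b x = 0.
Proof.
move=> cphi h0; apply: (cochain_eq0 (theta := theta) cphi) => t y.
have := h0 (pp t) (gm (pp t n) y); rewrite hom_pp // gmK // => /eqP.
by rewrite mulf_eq0 (negPf (scal_neq0 _ _ _)) => /eqP.
Qed.

Lemma dep_pp n t t' : (forall i, (i < n)%N -> t i = t' i) ->
  forall j, (j <= n)%N -> pp t j = pp t' j.
Proof. by move=> e; elim=> [|j IH] //= lj; rewrite IH ?e // ltnW. Qed.

(** By equivariance [K] is determined on simplices starting at the identity. There [hom_pp] forces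
    the values on Weyl elements, and these extend multilinearly. *)
Lemma hom_surj n K : gequiv K -> homog n.+1 K ->
  exists psi, chain n psi /\ forall g x, homc n psi g x = K g x.
Proof.
move=> eK dK.
pose c t y := K (pp t) (gm (pp t n) y) / scal n t (gm (pp t n) y).
have cpsi := ext_cochain theta n c.
exists (ext theta n c); split=> // g x.
pose t j := gm (gi (g j)) (g j.+1).
have gE : g = fun j => gm (g 0%N) (pp t j).
  apply: funext; elim=> [|j IH] /=; first by rewrite gm1.
  by rewrite gmA // -IH gmKi.
rewrite gE hom_equiv // eK; congr (_ * _); move: (gconj _ x) => {gE}y.
rewrite hom_pp // ext_E; first by rewrite /c gmKi // mulrC divfK ?scal_neq0.
move=> s s' e; have pe := dep_pp e.
rewrite /c /scal !pe //; congr (_ / (_ * _)).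
  by apply: dK => i li; apply: pe.
by apply: eq_bigr => i _; rewrite !pe // ltnW.
Qed.

Lemma coboundary_hom n phi K : chain n.+1 phi -> gequiv K -> homog n.+1 K ->
    (forall g x, homc n.+1 phi g x = diff n.+1 (fun g' => K g' x) g) ->
  @coboundary B (@badd k) (@bscale k) mul n.+1 phi.
Proof.
move=> cphi eK dK KF; have [psi [cpsi psiK]] := hom_surj eK dK.
exists psi; split=> // b x; apply/eqP; rewrite -subr_eq0; apply/eqP.
(* A family with one member, so that [cochain_comb] makes [phi] minus the differential of [psi] a
   cochain; injectivity of [homc] then kills it. *)
pose f (i : 'I_1) := delta n psi.
have cf i : chain n.+1 (f i) by apply: hdelta_cochain.
have := hom_inj (cochain_comb (fun=> 1) cf cphi) _ b x.
rewrite big_ord_recl big_ord0 mul1r addr0; apply=> g y.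
rewrite /homc /f big_ord_recl big_ord0 mul1r addr0 -/(homc n.+1 phi g y).
rewrite -/(homc n.+1 (delta n psi) g y) KF hom_delta //; apply/eqP; rewrite subr_eq0; apply/eqP.
by apply: eq_diff => g'; rewrite psiK.
Qed.
End Homogeneous.

(** * Exactness of the equivariant complex *)

Section Primitives.
Variables (theta : Rdefinitions.R) (k' : nat).
Notation k := k'.+1.
Hypothesis HK : k \in [:: 3; 4; 6]%N.
Notation T := (basis k).
Notation chi := (@chi theta k').
Notation gequiv := (@gequiv theta k').
Notation one := (g1 k').
Implicit Types (F K : (nat -> T) -> T -> CC) (w : vec) (s : 'I_k) (g : nat -> T) (h x : T).

Definition tr w : T := (w, 0).

Lemma conjE h x :
  gconj h x = (act (- h.2) (x.1 - h.1 + act x.2 h.1), x.2).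
Proof.
rewrite /gconj /gm /=; congr pair; last by rewrite addrC addrA subrr add0r.
rewrite actM // -[X in X + _ + _]actN -!actD; congr act.
by rewrite addrC [in RHS]addrC addrA [in RHS]addrA addrAC.
Qed.

Lemma conj_tr w x : gconj (tr w) x = (x.1 - w + act x.2 w, x.2).
Proof. by rewrite conjE /= oppr0 act0v. Qed.

Lemma ee_act s w x : ee (act s w) (act s x.1, x.2) = ee w x.
Proof.
have e : act x.2 (act s w) = act s (act x.2 w) by rewrite -!actM // addrC.
by rewrite /ee /= e !om_act.
Qed.

Definition zequiv F := forall w g x,
  F (fun j => gm (tr w) (g j)) x = chi (tr w) x * F g (gconj (tr w) x).

Lemma average n F K : gequiv F -> zequiv K -> homog n.+1 K ->
    (forall g x, F g x = diff n.+1 (fun g' => K g' x) g) ->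
  exists K', [/\ gequiv K', homog n.+1 K' &
    forall g x, F g x = diff n.+1 (fun g' => K' g' x) g].
Proof.
move=> eF zK dK FK.
(* Gamma is commutative, so [(act s x.1, x.2)] is the conjugate s x s^-1; elements of Gamma carry no
   phase, since [ee] vanishes at w = 0. *)
pose K' g x := k%:R^-1 * \sum_s K (fun j => gm (0, s) (g j)) (act s x.1, x.2).
exists K'; split.
- move=> h g x; rewrite /K' mulrCA conjE; congr (_ * _).
  (* Since (0, s)h is the translation by s h.1 times (0, s + h.2), reindexing absorbs the Gamma part
     of [h] and [zequiv] handles the translation. *)
  rewrite mulr_sumr [RHS](reindex_inj (addIr h.2)); apply: eq_bigr => s _.
  transitivity (K (fun j => gm (tr (act s h.1)) (gm (0, s + h.2) (g j))) (act s x.1, x.2)).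
    congr K; apply: funext => j; rewrite gmA // gmA //; congr gm.
    by rewrite /gm /= actv0 !add0r addr0.
  rewrite zK; congr (_ * K _ _).
    by rewrite /chi /tr /= ee_act.
  rewrite conj_tr /=; congr pair.
  rewrite actM // actKN // !actD actN; congr (_ + _).
  by rewrite -!actM // addrC.
- move=> x g g' e; rewrite /K'; congr (_ * _); apply: eq_bigr => s _.
  by apply: dK => i li; rewrite e.
- move=> g x; rewrite /K' diffZ diff_sum.
  rewrite (eq_bigr (fun=> F g x)).
    rewrite sumr_const card_ord -[F g x *+ _]mulr_natl mulrA mulVf ?mul1r //.
    by rewrite pnatr_eq0.
  move=> s _.
  rewrite (_ : diff _ _ _ =
    diff n.+1 (fun g' => K g' (act s x.1, x.2)) (fun j => gm (0, s) (g j))) //.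
  rewrite -FK eF /chi /ee /= !actv0 !om0r subr0 hlam0 mul1r; congr F.
  by rewrite conjE /= actv0 subr0 addr0 actNK //; case: (x).
Qed.

Definition center_num x : vec := x.1 - act (- x.2) x.1.

(* The integral part of the fixed point [(1 - g)^-1 v] of [x = (v, g)];
   [1 - g^-1] is the adjugate of [1 - g]. *)
Definition center x : T :=
  tr (divz (center_num x).1 (dt x.2), divz (center_num x).2 (dt x.2)).

Lemma center_num_conj w x : center_num (gconj (tr w) x) =
  center_num x - (dt x.2 * w.1, dt x.2 * w.2).
Proof.
rewrite conj_tr /center_num -(act_dt HK) -[(_, x.2).1]/(x.1 - w + act x.2 w) -[(_, x.2).2]/x.2.
rewrite !(actD, actN).
move: (act (- x.2) (act x.2 w)) (act (- x.2) x.1) (act (- x.2) w) (act x.2 w) x.1 => a b c d e.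
by apply: vec_eq => /=; ring.
Qed.

(** Conjugation moves the rational fixed point by the integral vector -w, and taking integral parts
    commutes with integral shifts. This makes [center] an equivariant cone vertex. *)
Lemma center_conj w x : x.2 != 0 -> gm (tr w) (center (gconj (tr w) x)) = center x.
Proof.
move=> x2; have D0 := dt_neq0 HK x2.
rewrite /center center_num_conj conj_tr /gm act0v addr0; congr pair.
move: (center_num x) => y.
have e m n : m + ((n - dt x.2 * m) %/ dt x.2)%Z = (n %/ dt x.2)%Z.
  by rewrite addrC [n - _]addrC -mulrN mulrC divzMDl // addrC addrA subrr add0r.
by apply: vec_eq; exact: e.
Qed.

(** Chosen so that [om x.1 (perp x)] is p^2 + q^2 for [x.1] = (p, q). *)
Definition perp x : vec := (x.1.2, - x.1.1).

Hypothesis irr : irrational theta.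

Lemma chi_perp_neq1 x : x.1 != 0 -> x.2 = 0 -> chi (tr (perp x)) x != 1.
Proof.
move=> x1 x2; rewrite /chi /ee x2 !act0v omvv subr0; apply: hlam_double_neq1 => //.
apply: contraNneq x1 => e; apply/eqP; apply: vec_eq; move: e; rewrite /om /=; nia.
Qed.

(* Off the class of 1 the Z^2-equivariant complex is contractible: for [g <> 1]
   because the fixed point of the affine map [x] gives an equivariant vertex,
   for a translation because translating by [perp x] is both homotopic to the
   identity and multiplication by a scalar [<> 1]. *)
Lemma zprimitive_exists n F (K1 : (nat -> T) -> CC) :
    gequiv F -> homog n.+2 F ->
    (forall g x, diff n.+2 (fun g' => F g' x) g = 0) ->
    dep n.+1 K1 -> (forall w g, K1 (fun j => gm (tr w) (g j)) = K1 g) ->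
    (forall g, diff n.+1 K1 g = F g one) ->
  exists K, [/\ zequiv K, homog n.+1 K &
    forall g x, F g x = diff n.+1 (fun g' => K g' x) g].
Proof.
move=> eF dF DF dK1 iK1 DK1.
pose K g x := if x.2 != 0 then F (scons (center x) g) x
  else if x.1 != 0 then
    (chi (tr (perp x)) x - 1)^-1 * prism (gm (tr (perp x))) n.+2 (fun g' => F g' x) g
  else K1 g.
exists K; split.
- move=> w g x; have [x2|x2] := eqVneq x.2 0; last first.
    rewrite /K (_ : (gconj (tr w) x).2 = x.2) ?x2 -?eF; last by rewrite conj_tr.
    by congr F; apply: funext => -[|j] //=; rewrite center_conj.
  have cx w' : gconj (tr w') x = x.
    by rewrite conj_tr x2 act0v addrNK -x2; case: (x).
  rewrite cx /K x2 eqxx; have [x1|x1] := eqVneq x.1 0.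
    by rewrite /= iK1 /chi /ee /= x1 !om0l x2 act0v omvv subr0 addr0 hlam0 mul1r.
  rewrite mulrCA; congr (_ * _); apply: (@prism_equivariant _ _ _ (gm (tr w))).
    move=> p; rewrite !gmA //; congr gm.
    by rewrite /gm /= !act0v addr0 addrC.
  by move=> h; rewrite eF cx.
- move=> x; rewrite /K; case: (x.2 != 0); first exact: (dep_scons _ (dF x)).
  case: (x.1 != 0) => // g g' e; congr (_ * _); exact: (dep_prism _ (dF x)).
- move=> g x; rewrite /K; have [x2|x2] := eqVneq x.2 0; last first.
    by rewrite /= (cone_diff (center x) (DF^~ x)).
  have [x1|x1] := eqVneq x.1 0.
    by rewrite /= DK1; congr F; case: (x) x1 x2 => /= ? ? -> ->.
  rewrite /= diffZ; have c1 := chi_perp_neq1 x1 x2.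
  (* As [F] is a cocycle and the translation fixes [x], the homotopy formula says that the prism has
     coboundary (chi - 1)F. *)
  have := prism_homotopy (gm (tr (perp x))) (dF x) g.
  have -> : diff n.+2 (fun g' => F g' x) = fun=> 0 by apply: funext => h.
  rewrite prism0 addr0 => ->; rewrite eF.
  rewrite (_ : gconj _ x = x); last by rewrite conj_tr x2 act0v addrNK -x2; case: (x).
  rewrite -[X in _ * (_ - X)]mul1r -mulrBl mulrA mulVf ?mul1r // subr_eq0 //.
Qed.

Lemma chi1 h : chi h one = 1.
Proof. by rewrite /chi /ee /= !om0l act0v omvv subr0 addr0 hlam0. Qed.

Lemma gconj1 h : gconj h one = one.
Proof. by rewrite /gconj gm1 giK. Qed.

Lemma gequiv1 F h g : gequiv F -> F (fun j => gm h (g j)) one = F g one.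
Proof. by move=> eF; rewrite eF chi1 gconj1 mul1r. Qed.

Definition shift1 (m : int) (t : T) : T := gm (tr (m, 0)) t.
Definition shift2 (m : int) (t : T) : T := gm (tr (0, m)) t.

Lemma tr_mul v w t : gm (tr v) (gm (tr w) t) = gm (tr (v + w)) t.
Proof. by rewrite gmA // /gm /= act0v addr0. Qed.

Lemma shift1D m n t : shift1 (m + n) t = shift1 m (shift1 n t).
Proof. by rewrite /shift1 tr_mul. Qed.
Lemma shift2D m n t : shift2 (m + n) t = shift2 m (shift2 n t).
Proof. by rewrite /shift2 tr_mul. Qed.
Lemma tr0 t : gm (tr 0) t = t.
Proof. exact: g1m. Qed.
Lemma shift1_height t : (shift1 1 t).1.1 = t.1.1 + 1.
Proof. rewrite /shift1 /gm act0v; exact: addrC. Qed.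
Lemma shift2_height t : (shift2 1 t).1.2 = t.1.2 + 1.
Proof. rewrite /shift2 /gm act0v; exact: addrC. Qed.
Lemma shift1_height2 t : (shift1 1 t).1.2 = t.1.2.
Proof. rewrite /shift1 /gm act0v; exact: add0r. Qed.
Lemma shiftC m n t : shift1 m (shift2 n t) = shift2 n (shift1 m t).
Proof. by rewrite /shift1 /shift2 !tr_mul addrC. Qed.

Lemma invariant_int (t : int -> T -> T) (K1 : (nat -> T) -> CC) :
    (forall m n p, t (m + n) p = t m (t n p)) -> (forall p, t 0 p = p) ->
  invariant_under (t 1) K1 -> forall m, invariant_under (t m) K1.
Proof.
move=> tD t0 i1.
have iN n : invariant_under (t n%:Z) K1.
  elim: n => [|n IH] g; first by congr K1; apply: funext => j; rewrite t0.
  rewrite -[RHS]IH -[RHS]i1; congr K1; apply: funext => j.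
  by rewrite -tD; congr t; rewrite -addn1 PoszD addrC.
case=> [n|n]; first exact: iN.
move=> g; rewrite -[LHS](iN n.+1); congr K1; apply: funext => j.
by rewrite -tD NegzE subrr t0.
Qed.

Lemma invariant_shifts (K1 : (nat -> T) -> CC) :
    invariant_under (shift1 1) K1 -> invariant_under (shift2 1) K1 ->
  forall w g, K1 (fun j => gm (tr w) (g j)) = K1 g.
Proof.
move=> i1 i2 w g.
rewrite -[RHS](invariant_int shift2D tr0 i2 w.2) -[RHS](invariant_int shift1D tr0 i1 w.1).
congr K1; apply: funext => j; rewrite /shift1 /shift2 tr_mul; congr (gm (tr _) _).
by apply: vec_eq => /=; rewrite ?addr0 ?add0r.
Qed.

Definition torus_pairing F : CC := torus shift1 shift2 one (fun g => F g one).

(** Here [F] has degree n + 1. Obstructions can occur only at x = 1: the values there in degree 1,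
    the torus pairing in degree 2. *)
Lemma equiv_exact n F : gequiv F -> homog n.+2 F ->
    (forall g x, diff n.+2 (fun g' => F g' x) g = 0) ->
    (n = 0%N -> forall g, F g one = 0) ->
    (n = 1%N -> torus_pairing F = 0) ->
  exists K, [/\ gequiv K, homog n.+1 K &
    forall g x, F g x = diff n.+1 (fun g' => K g' x) g].
Proof.
move=> eF dF DF F0 F1.
have iF w : invariant_under (gm (tr w)) (fun g => F g one).
  by move=> g; apply: gequiv1.
suff [K1 [dK1 iK1 DK1]] : exists K1 : (nat -> T) -> CC, [/\ dep n.+1 K1,
    (forall w g, K1 (fun j => gm (tr w) (g j)) = K1 g) &
    (forall g, diff n.+1 K1 g = F g one)].
  have [K [zK dK DK]] := zprimitive_exists eF dF DF dK1 iK1 DK1.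
  exact: average zK dK DK.
case: n dF DF F0 F1 => [|[|n]] dF DF F0 F1.
- exists (fun=> 0); split=> // g; rewrite F0 // /diff big1 // => i _; exact: mulr0.
- have [K1 [d i1 i2 e]] := chase_2 shift1D tr0 shift2D tr0 shift1_height
    shift2_height shift1_height2 shiftC (dF one) (DF^~ one) (iF _) (iF _) (F1 erefl).
  by exists K1; split=> //; apply: invariant_shifts.
- have [K1 [d i1 i2 e]] := chase_ge3 one shift1D tr0 shift2D tr0 shift1_height
    shift2_height shift1_height2 shiftC (dF one) (DF^~ one) (iF _) (iF _).
  by exists K1; split=> //; apply: invariant_shifts.
Qed.
End Primitives.

(** * Positive degrees *)

Lemma additive_intM (f : vec -> CC) : (forall v w, f (v + w) = f v + f w) ->
  forall n v, f (n * v.1, n * v.2) = n%:~R * f v.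
Proof.
move=> fD n v.
have f0 : f 0 = 0 by apply: (addrI (f 0)); rewrite -fD !addr0.
have fP m u : f (m%:Z * u.1, m%:Z * u.2) = m%:R * f u.
  elim: m => [|m IH]; first by rewrite !mul0r f0.
  have -> : (m.+1%:Z * u.1, m.+1%:Z * u.2) = u + (m%:Z * u.1, m%:Z * u.2) :> vec.
    by apply: vec_eq; rewrite /= -addn1 PoszD; ring.
  by rewrite fD IH -natr1; ring.
case: n => m; first exact: fP.
have fN u : f (- u) = - f u by apply: (addrI (f u)); rewrite -fD !subrr f0.
rewrite NegzE intrN [RHS]mulNr -[_ * f v]fP -fN; congr f.
by apply: vec_eq; rewrite /= mulNr.
Qed.

Section PositiveDegree.
Variables (theta : Rdefinitions.R) (k' : nat).
Notation k := k'.+1.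
Hypothesis HK : k \in [:: 3; 4; 6]%N.
Hypothesis irr : irrational theta.
Notation T := (basis k).
Notation B := (Alg k).
Notation mul := (@bmul theta k).
Notation chi := (@chi theta k').
Notation gequiv := (@gequiv theta k').
Notation chain n phi := (@cochain B (@badd k) (@bscale k) n phi).
Notation delta := (@hdelta B mul).
Notation homc := (@homc theta k').
Notation one := (g1 k').
Implicit Types (F K : (nat -> T) -> T -> CC) (w : vec) (s : 'I_k) (g : nat -> T) (h l x : T).

(** Such a map kills the finite group Gamma, so it is Gamma-invariant on Z^2 and kills (1 - g)Z^2,
    which has finite index for g <> 1. *)
Lemma hom_to_CC_trivial (f : T -> CC) :
  (forall h l, f (gm h l) = f h + f l) -> forall h, f h = 0.
Proof.
move=> fM.
have f1 : f one = 0 by apply: (addrI (f one)); rewrite -fM gm1 addr0.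
have fs s : f (0, s) = 0.
  have fn m : f (0, s *+ m) = m%:R * f (0, s).
    elim: m => [|m IH]; first by rewrite mul0r.
    have -> : (0, s *+ m.+1) = gm (0, s) (0, s *+ m) :> T by rewrite /gm /= actv0 addr0 mulrS.
    by rewrite fM IH -natr1; ring.
  have := fn k; rewrite (_ : s *+ k = 0); last first.
    by rewrite Zp_mulrn; apply: val_inj; rewrite /= modnMl.
  by rewrite f1 => /esym/eqP; rewrite mulf_eq0 pnatr_eq0 => /eqP.
have fD v w : f (tr k' (v + w)) = f (tr k' v) + f (tr k' w).
  by rewrite -fM /gm /= act0v addr0.
have fact s w : f (tr k' (act s w)) = f (tr k' w).
  have -> : tr k' (act s w) = gm (0, s) (gm (tr k' w) (0, - s)).
    by rewrite /gm /= actv0 addr0 !add0r subrr.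
  by rewrite !fM !fs add0r addr0.
have ft w : f (tr k' w) = 0.
  have [s s0] : exists s : 'I_k, s != 0.
    exists (inord 1); rewrite -val_eqE /= inordK //.
    by move: HK; rewrite !inE => /or3P[] /eqP ->.
  have := additive_intM fD (dt s) w; rewrite -(act_dt HK) fD -[- act (- s) _]actN fact.
  rewrite -fD subrr f1 => /esym/eqP.
  by rewrite mulf_eq0 intr_eq0 (negPf (dt_neq0 HK s0)) => /eqP.
move=> [w s]; have -> : (w, s) = gm (tr k' w) (0, s) by rewrite /gm /= act0v addr0 add0r.
by rewrite fM ft fs addr0.
Qed.

(** At x = 1 the phases are trivial, so F(1, h) is a homomorphism in h from G to C. *)
Lemma degree1_trivial F : gequiv F -> homog 2 F ->
    (forall g x, diff 2 (fun g' => F g' x) g = 0) -> forall g, F g one = 0.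
Proof.
move=> eF dF DF g; pose f h := F (scons one (fun=> h)) one.
have FE h l r : F (scons h (scons l r)) one = f (gm (gi h) l).
  rewrite /f -[RHS](gequiv1 h _ eF); apply: dF => -[|[|i]] //= _; first by rewrite gm1.
  by rewrite gmKi.
have fM h l : f (gm h l) = f h + f l.
  have := DF (scons one (scons h (fun=> gm h l))) one; rewrite !diff_scons diff0.
  have -> : (fun=> gm h l) = scons (gm h l) (fun=> gm h l) by apply: funext => -[].
  rewrite !FE gmK // gi1 // !g1m => /eqP.
  by rewrite opprB addrA subr_eq0 addrC => /eqP.
have -> : g = scons (g 0%N) (scons (g 1%N) (fun j => g j.+2)) by apply: funext => -[|[]].
by rewrite FE (hom_to_CC_trivial fM).
Qed.

Lemma hom_cocycle n phi : chain n phi -> (forall b (x : B), delta n phi b x = 0) ->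
  forall g x, diff n.+1 (fun g' => homc n phi g' x) g = 0.
Proof. by move=> cphi dphi g x; rewrite -hom_delta // /homc dphi. Qed.

Lemma HH_vanish n : n != 1%N -> HH_crossed theta k n.+1 0.
Proof.
move=> n1; exists (fun _ _ _ => 0); split=> [[]//|phi [cphi dphi]|? ? []//].
exists (fun=> 0).
rewrite (_ : (fun b (x : B) => _) = phi); last first.
  by apply: funext => b; apply: funext => x; rewrite big_ord0 subr0.
have [|||||K [eK dK DK]] := @equiv_exact theta k' HK irr n (homc n.+1 phi).
- exact: hom_equiv.
- exact: hom_dep.
- exact: hom_cocycle.
- move=> n0; rewrite n0 in cphi dphi *; apply: degree1_trivial.
  + exact: hom_equiv.
  + exact: hom_dep.
  + exact: hom_cocycle.
- by move=> e; rewrite e eqxx in n1.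
exact: coboundary_hom cphi eK dK DK.
Qed.

(** Up to sign, twice the oriented area of the triangle, placed on the class of 1; it is invariant
    because Gamma has determinant 1. *)
Definition area g x : CC :=
  if x == one then (om ((g 1%N).1 - (g 0%N).1) ((g 2%N).1 - (g 0%N).1))%:~R else 0.

Lemma area_dep : homog 3 area.
Proof. by move=> x g g' e; rewrite /area !e. Qed.

Lemma gconj_eq1 h x : (gconj h x == one) = (x == one).
Proof.
apply/eqP/eqP => [e|->]; last exact: gconj1.
have : gm (gm h (gconj h x)) (gi h) = one by rewrite e gm1 gKi.
by rewrite /gconj -!gmA // gKi // gm1 gmKi.
Qed.

Lemma gm_sub h l x : (gm h l).1 - (gm h x).1 = act h.2 (l.1 - x.1).
Proof.
rewrite -[(gm h l).1]/(h.1 + act h.2 l.1) -[(gm h x).1]/(h.1 + act h.2 x.1).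
by rewrite opprD addrACA subrr add0r actD actN.
Qed.

Lemma area_equiv : gequiv area.
Proof.
move=> h g x; rewrite /area gconj_eq1; have [->|_] := eqVneq x one; last by rewrite mulr0.
by rewrite chi1 mul1r !gm_sub om_act.
Qed.

Lemma area_cocycle g x : diff 3 (fun g' => area g' x) g = 0.
Proof.
rewrite /diff /area; have [_|_] := eqVneq x one; last by rewrite big1 // => i _; rewrite mulr0.
rewrite !big_ord_recl big_ord0 /bump /= !addn0 !add1n.
rewrite /om /= !(intrD, intrB, intrM, intrN); ring.
Qed.

Lemma area_torus : torus_pairing area = -2.
Proof.
rewrite /torus_pairing /torus /area eqxx /shift1 /shift2 /gm /= !actE -intrB.
rewrite -[RHS]/((-2)%:~R); congr (_%:~R).
by rewrite /om /= /gmat expr0 !mxE.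
Qed.

Lemma HH2 : HH_crossed theta k 2 1.
Proof.
have [psi [cpsi psiE]] := hom_surj HK area_equiv area_dep.
have psi0 b (x : B) : delta 2 psi b x = 0.
  apply: (hom_inj (theta := theta) HK (hdelta_cochain theta cpsi)) => g y; rewrite hom_delta //.
  rewrite -[RHS](area_cocycle g y); apply: eq_diff => h; exact: psiE.
exists (fun=> psi); split.
- by split.
- move=> phi [cphi dphi].
  (* Each triangle of the torus contributes -1 to the pairing with [area], so this coefficient makes
     the pairing of the difference vanish. *)
  pose c : 'I_1 -> CC := fun=> torus_pairing (homc 2 phi) / -2.
  exists c.
  have cx := cochain_comb c (fun=> cpsi) cphi; set xi := fun b (x : B) => _ in cx *.
  have xiE g x : homc 2 xi g x = homc 2 phi g x - c 0 * area g x.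
    by rewrite /homc /xi big_ord_recl big_ord0 addr0 -[psi _ _]/(homc 2 psi g x) psiE.
  have [|||||K [eK dK DK]] := @equiv_exact theta k' HK irr 1 (homc 2 xi).
  + exact: hom_equiv.
  + exact: hom_dep.
  + move=> g x; rewrite (eq_diff _ (F' := fun g' => homc 2 phi g' x - c 0 * area g' x)) //.
    by rewrite diffB diffZ area_cocycle hom_cocycle // mulr0 subr0.
  + by [].
  + move=> _.
    have -> : torus_pairing (homc 2 xi) = torus_pairing (homc 2 phi) - c 0 * torus_pairing area.
      by rewrite /torus_pairing /torus !xiE; ring.
    by rewrite area_torus /c divfK ?subrr // oppr_eq0 pnatr_eq0.
  exact: coboundary_hom cx eK dK DK.
- move=> c [eta [ceta etaE]] i; rewrite ord1.
  have DE g : diff 2 (fun g' => homc 1 eta g' one) g = c 0 * area g one.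
    rewrite -hom_delta // /homc -etaE big_ord_recl big_ord0 addr0.
    by rewrite -[psi _ _]/(homc 2 psi g one) psiE.
  have iK w g : homc 1 eta (fun j => gm (tr k' w) (g j)) one = homc 1 eta g one.
    by apply: (gequiv1 _ _ (F := homc 1 eta)); apply: hom_equiv.
  (* By Stokes a coboundary of a translation-invariant cochain pairs to zero with the torus, whereas
     [area] does not. *)
  have := torus_diff one (@shiftC k' HK) (hom_dep theta ceta one) DE.
  have -> : scons (shift2 1 one) (fun=> shift2 1 (shift1 1 one)) =
      (fun j => shift2 1 (scons one (fun=> shift1 1 one) j)) by apply: funext => -[].
  have -> : scons (shift1 1 one) (fun=> shift1 1 (shift2 1 one)) =
      (fun j => shift1 1 (scons one (fun=> shift2 1 one) j)) by apply: funext => -[].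
  rewrite !iK !subrr addr0 (_ : torus _ _ _ _ = c 0 * torus_pairing area); last first.
    by rewrite /torus_pairing /torus mulrBr.
  rewrite area_torus.
  by move/eqP; rewrite mulf_eq0 oppr_eq0 pnatr_eq0 orbF => /eqP.
Qed.
End PositiveDegree.

(** * Degree zero *)

Section DegreeZero.
Variables (theta : Rdefinitions.R) (k' : nat).
Notation k := k'.+1.
Hypothesis HK : k \in [:: 3; 4; 6]%N.
Hypothesis irr : irrational theta.
Notation T := (basis k).
Notation B := (Alg k).
Notation chi := (@chi theta k').
Notation homc := (@homc theta k').
Notation one := (g1 k').
Implicit Types (w v : vec) (s : 'I_k) (g : nat -> T) (h l x : T) (f : T -> CC).

Definition twisted_class_fun f := forall h x, f x = chi h x * f (gconj h x).

(** The homogeneous form of a 0-cocycle does not depend on its vertex and is a function of [x]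
    alone. Evaluation at the points [r i] is then dual, up to nonzero factors, to the basis [e]. *)
Lemma HH0_twisted_class_fun d (e : 'I_d -> T -> CC) (r : 'I_d -> T) :
    (forall i, twisted_class_fun (e i)) ->
    (forall i j, j != i -> e i (r j) = 0) -> (forall i, e i (r i) != 0) ->
    (forall f, twisted_class_fun f -> (forall i, f (r i) = 0) -> forall x, f x = 0) ->
  HH_crossed theta k 0 d.
Proof.
move=> te e0 e1 span.
have /choice [f fE] : forall i, exists psi,
    @cochain B (@badd k) (@bscale k) 0 psi /\ forall g x, homc 0 psi g x = e i x.
  by move=> i; apply: (hom_surj HK (K := fun=> e i)) => // h g x; apply: te.
have hsum (c : 'I_d -> CC) g x : homc 0 (fun b y => \sum_i c i * f i b y) g x
    = \sum_i c i * e i x.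
  by rewrite {1}/homc; apply: eq_bigr => i _; rewrite -((fE i).2 g).
exists f; split.
- move=> i; have [ci fi] := fE i; split=> // b y.
  apply: (hom_inj (theta := theta) HK (hdelta_cochain theta ci)) => g x.
  rewrite hom_delta // (eq_diff _ (F' := fun=> e i x)); last by move=> h; apply: fi.
  by rewrite diffS diff0 subrr.
- move=> phi [cphi dphi].
  pose F x := homc 0 phi (fun=> one) x.
  have FE g x : homc 0 phi g x = F x.
    have := hom_cocycle HK cphi dphi (scons one g) x; rewrite diff_scons diff0.
    move/eqP; rewrite subr_eq0 => /eqP ->.
    by apply: (hom_dep theta cphi x) => -[].
  have tF : twisted_class_fun F.
    by move=> h x; rewrite -(FE (fun j => gm h one)) hom_equiv // FE.
  pose c i := F (r i) / e i (r i); exists c.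
  have cxi := cochain_comb c (fun i => (fE i).1) cphi.
  apply: (hom_inj (theta := theta) HK cxi) => g x.
  rewrite (_ : homc _ _ _ _ = F x - \sum_i c i * e i x); last by rewrite -(hsum c g) -(FE g).
  apply: (span (fun x => F x - \sum_i c i * e i x)) => [h y|j].
    rewrite mulrBr -tF mulr_sumr; congr (_ - _); apply: eq_bigr => i _.
    by rewrite mulrCA -te.
  rewrite (bigD1 j) //= big1 => [|i ij]; last by rewrite e0 ?mulr0 // eq_sym.
  by rewrite addr0 /c divfK // subrr.
- move=> c c0 i.
  have := hsum c (fun=> one) (r i); rewrite {1}/homc c0 (bigD1 i) //= big1 => [|j ji].
    by rewrite addr0 => /esym/eqP; rewrite mulf_eq0 (negPf (e1 i)) orbF => /eqP.
  by rewrite e0 ?mulr0 // eq_sym.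
Qed.

(* The phase [om v (g v) / (2 D)], with [D = det (1 - g)], is the quadratic form
   [om u (g u) / 2] at the fixed point [u] of [x]; its polarisation is [ee]. *)
Definition gauge x : CC :=
  lampow theta ((om x.1 (act x.2 x.1))%:~R / (2 * (dt x.2)%:~R)).

Lemma om_ee w x : let u := x.1 - w + act x.2 w in
  om x.1 (act x.2 x.1) = dt x.2 * ee w x + om u (act x.2 u).
Proof.
set u := _ - _ + _; have := det2_gmat HK x.2.
(* As polynomials in the matrix entries the two sides of the claim differ by a multiple of det g -
   1. *)
have : om x.1 (act x.2 x.1) - om u (act x.2 u) = dt x.2 * ee w x
   + (det2 (gmat x.2) - 1) * (2 * om x.1 w - om w (act x.2 w)).
  by rewrite /u /ee /det2 /dt /om /act /act_vec /=; ring.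
by move=> e d; move: e; rewrite d subrr mul0r addr0 => /eqP; rewrite subr_eq => /eqP.
Qed.

(** Over g <> 1, dividing by [gauge] turns twisted class functions into ordinary ones, so every
    conjugacy class there contributes one dimension. *)
Lemma gauge_twisted h x : x.2 != 0 -> gauge x = chi h x * gauge (gconj h x).
Proof.
move=> x2; rewrite /chi /gauge /hlam -lampowD; congr (lampow theta _).
rewrite conjE // (om_ee h.1); set u := x.1 - _ + _.
have -> : om (act (- h.2) u) (act x.2 (act (- h.2) u)) = om u (act x.2 u).
  by rewrite -actM // addrC actM // om_act.
rewrite intrD intrM; field; rewrite intr_eq0; exact: dt_neq0.
Qed.

Lemma gen_invariant (A : Type) (c : vec -> A) :
    (forall v, c (act_vec (gen k) v.1 v.2) = c v) -> forall s v, c (act s v) = c v.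
Proof.
move=> cg s v; rewrite /act /gmat; elim: (nat_of_ord s) v => [|m IH] v.
  by rewrite expr0 mx2_1 /act_vec !mxE /= !mul1r !mul0r addr0 add0r; case: v.
by rewrite exprS act_vecM cg IH.
Qed.

(** The dimension becomes a count: 0 labels the class of 1, and [cl] labels the [d] classes over g
    <> 1. *)
Lemma HH0_classes d (cl : 'I_k -> vec -> nat) (r : nat -> T) :
    (forall s v w, s != 0 -> cl s (v - w + act s w) = cl s v) ->
    (forall s v, s != 0 -> cl s (act_vec (gen k) v.1 v.2) = cl s v) ->
    (forall s v, s != 0 ->
      (cl s v < d.+1)%N /\ exists h, gconj h (v, s) = r (cl s v)) ->
    r 0%N = one ->
    (forall i, (0 < i < d.+1)%N -> (r i).2 != 0 /\ cl (r i).2 (r i).1 = i) ->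
  HH_crossed theta k 0 d.+1.
Proof.
move=> clw clg clr r0 rP.
(* The label [d.+1], outside the index range, marks the nontrivial translations, which carry no
   twisted class function. *)
pose c x : nat := if x.2 != 0 then cl x.2 x.1 else if x.1 == 0 then 0%N else d.+1.
have c_conj h x : c (gconj h x) = c x.
  rewrite /c conjE //= ; have [x2|x2] := eqVneq x.2 0; last first.
    by rewrite (gen_invariant (c := cl x.2)) ?clw // => v; apply: clg.
  rewrite /= x2 act0v addrNK; congr (if _ then _ else _).
  apply/eqP/eqP => [e|->]; last exact: actv0.
  by rewrite -(actKN HK h.2 x.1) e actv0.
have cr (i : 'I_d.+1) : c (r i) = i.
  rewrite /c; case: (posnP i) => [->|i0]; first by rewrite r0 !eqxx.
  by have [|-> ->] := rP i; rewrite ?i0 /=.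
pose e (i : 'I_d.+1) x : CC :=
  if c x == i then (if x.2 != 0 then gauge x else 1) else 0.
apply: (@HH0_twisted_class_fun _ e (fun i => r i)).
- move=> i h x; rewrite /e c_conj; case: eqP => ci; last by rewrite mulr0.
  have [x2|x2] := eqVneq x.2 0; last by rewrite conjE // x2 -conjE // -gauge_twisted.
  have x1 : x.1 = 0.
    apply: contraTeq (ltn_ord i) => x1; rewrite -ci /c x2 eqxx (negPf x1) /=.
    by rewrite ltnn.
  by rewrite conjE // x2 eqxx mulr1 /chi /ee x1 x2 !om0l act0v omvv subr0 addr0 hlam0.
- by move=> i j ji; rewrite /e cr val_eqE (negPf ji).
- move=> i; rewrite /e cr eqxx; case: ifP => _; [exact: lampow_neq0 | exact: oner_neq0].
- move=> f tf f0 x; have [x2|x2] := eqVneq x.2 0; last first.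
    have [lc [h hr]] := clr x.2 x.1 x2.
    by rewrite (tf h) [x]surjective_pairing hr (f0 (Ordinal lc)) mulr0.
  have [x1|x1] := eqVneq x.1 0.
    by rewrite -(f0 ord0) r0; congr f; case: (x) x1 x2 => /= ? ? -> ->.
  (* This conjugation fixes [x] but multiplies by a phase different from 1, so [f x] vanishes. *)
  have := tf (tr k' (perp x)) x; rewrite conj_tr // x2 act0v addrNK -x2 -surjective_pairing.
  move/eqP; rewrite -[X in X == _]mul1r -subr_eq0 -mulrBl mulf_eq0 subr_eq0 eq_sym.
  by rewrite (negPf (chi_perp_neq1 HK irr x1 x2)) => /eqP.
Qed.
End DegreeZero.

(** * Conjugacy classes for the three groups *)

Lemma act_mx2 k' m (lm : (m < k'.+1)%N) a b c d :
    gen k'.+1 ^+ m = mx2 a b c d ->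
  forall v, act (Ordinal lm) v = (a * v.1 + b * v.2, c * v.1 + d * v.2).
Proof. by move=> e v; rewrite /act /gmat e /act_vec !mxE. Qed.

Ltac gen_power := by rewrite /gen /= ?exprS ?expr0 ?mulr1 ?mx2M; congr mx2.

Lemma gen3_1 : gen 3 ^+ 1 = mx2 0 1 (-1) (-1). Proof. gen_power. Qed.
Lemma gen3_2 : gen 3 ^+ 2 = mx2 (-1) (-1) 1 0. Proof. gen_power. Qed.

Lemma mod2_cases (n : int) : exists2 q : int,
  n = q * 2 + (n %% 2)%Z & (n %% 2)%Z = 0 \/ (n %% 2)%Z = 1.
Proof. by exists (n %/ 2)%Z; lia. Qed.

Lemma mod3_cases (n : int) : exists2 q : int, n = q * 3 + (n %% 3)%Z &
  [\/ (n %% 3)%Z = 0, (n %% 3)%Z = 1 | (n %% 3)%Z = 2].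
Proof.
exists (n %/ 3)%Z; first lia.
have : (n %% 3)%Z = 0 \/ (n %% 3)%Z = 1 \/ (n %% 3)%Z = 2 by lia.
by case=> [|[]]; [constructor 1|constructor 2|constructor 3].
Qed.

Section Three.
Notation T := (basis 3).

(* For [g <> 1] the conjugacy classes of the elements [(v, g)] are the orbits of
   Gamma on [Z^2 / (1 - g) Z^2]; [cl3], [cl4] and [cl6] number them from 1 on,
   in the order of the representatives. *)
Definition cl3 (s : 'I_3) (v : vec) : nat :=
  (3 * s - 2 + `|((v.1 - v.2) %% 3)%Z|)%N.
Definition reps3 : seq T :=
  [:: (0, 0); ((0, 0), @Ordinal 3 1 isT); ((1, 0), @Ordinal 3 1 isT); ((2, 0), @Ordinal 3 1 isT);
      ((0, 0), @Ordinal 3 2 isT); ((1, 0), @Ordinal 3 2 isT); ((2, 0), @Ordinal 3 2 isT)].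

(** For both g <> 1 the quotient Z^2 / (1 - g)Z^2 is Z/3 through v_1 - v_2, with trivial
    Gamma-action: 1 + 3 + 3 classes. *)
Lemma HH0_3 theta : irrational theta -> HH_crossed theta 3 0 7.
Proof.
move=> irr; apply: (@HH0_classes theta 2 isT irr 6 cl3 (nth (g1 2) reps3)) => //.
- move=> s v w; rewrite /cl3; case: s => [[|[|[|//]]] ls] // _.
  + by rewrite (@act_mx2 2 _ ls _ _ _ _ gen3_1) /=; lia.
  + by rewrite (@act_mx2 2 _ ls _ _ _ _ gen3_2) /=; lia.
- by move=> s v _; rewrite /cl3 /gen /= /act_vec !mxE /=; lia.
- move=> s v; rewrite /cl3; case: s => [[|[|[|//]]] ls] // _.
  + split; first by rewrite /=; lia.
    (* The translation w solves v - w + g w = (r, 0) with r the residue; the other witnesses arise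
       in the same way. *)
    have [q e c] := mod3_cases (v.1 - v.2); exists (tr 2 (v.2 + 2 * q, - q)).
    rewrite conj_tr // (@act_mx2 2 _ ls _ _ _ _ gen3_1).
    by case: c e => -> e; congr pair; (apply: vec_eq => /=; lia) || apply: val_inj.
  + split; first by rewrite /=; lia.
    have [q e c] := mod3_cases (v.1 - v.2); exists (tr 2 (q, v.2 + q)).
    rewrite conj_tr // (@act_mx2 2 _ ls _ _ _ _ gen3_2).
    by case: c e => -> e; congr pair; (apply: vec_eq => /=; lia) || apply: val_inj.
- move=> i; do 7?[case: i => [|i] //] => _; split; by [].
Qed.
End Three.

Lemma gen4_1 : gen 4 ^+ 1 = mx2 0 1 (-1) 0. Proof. gen_power. Qed.
Lemma gen4_2 : gen 4 ^+ 2 = mx2 (-1) 0 0 (-1). Proof. gen_power. Qed.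
Lemma gen4_3 : gen 4 ^+ 3 = mx2 0 (-1) 1 0. Proof. gen_power. Qed.

Section Four.
Notation T := (basis 4).

Definition cl4 (s : 'I_4) (v : vec) : nat :=
  if s == 2%N :> nat then
    if ((v.1 %% 2)%Z == 0) && ((v.2 %% 2)%Z == 0) then 5
    else if ((v.1 + v.2) %% 2)%Z == 0 then 6 else 7
  else (s + `|((v.1 + v.2) %% 2)%Z|)%N.
Definition reps4 : seq T :=
  [:: (0, 0); ((0, 0), @Ordinal 4 1 isT); ((1, 0), @Ordinal 4 1 isT);
      ((0, 0), @Ordinal 4 3 isT); ((1, 0), @Ordinal 4 3 isT);
      ((0, 0), @Ordinal 4 2 isT); ((1, 1), @Ordinal 4 2 isT); ((1, 0), @Ordinal 4 2 isT)].

(** The two elements of order 4 give Z/2 through v_1 + v_2. For g = -1 the quotient is (Z/2)^2,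
    where Gamma exchanges (1,0) and (0,1): 1 + 2 + 2 + 3 classes. *)
Lemma HH0_4 theta : irrational theta -> HH_crossed theta 4 0 8.
Proof.
move=> irr; apply: (@HH0_classes theta 3 isT irr 7 cl4 (nth (g1 3) reps4)) => //.
- move=> s v w; rewrite /cl4; case: s => [[|[|[|[|//]]]] ls] // _.
  + by rewrite (@act_mx2 3 _ ls _ _ _ _ gen4_1) /=; lia.
  + rewrite (@act_mx2 3 _ ls _ _ _ _ gen4_2) /=.
    congr (if _ then _ else _); first by apply/andP/andP => -[/eqP ? /eqP ?]; split; apply/eqP; lia.
    by congr (if _ then _ else _); apply/eqP/eqP; lia.
  + by rewrite (@act_mx2 3 _ ls _ _ _ _ gen4_3) /=; lia.
- move=> s v _; rewrite /cl4 /gen /= /act_vec !mxE /=; case: (s == 2%N :> nat); last by lia.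
  congr (if _ then _ else _); first by apply/andP/andP => -[/eqP ? /eqP ?]; split; apply/eqP; lia.
  by congr (if _ then _ else _); apply/eqP/eqP; lia.
- move=> s v; rewrite /cl4; case: s => [[|[|[|[|//]]]] ls] // _.
  + split; first by rewrite /=; lia.
    have [q e c] := mod2_cases (v.1 + v.2); exists (tr 3 (q, v.2 - q)).
    rewrite conj_tr // (@act_mx2 3 _ ls _ _ _ _ gen4_1).
    by case: c e => -> e; congr pair; (apply: vec_eq => /=; lia) || apply: val_inj.
  + split; first by rewrite /=; do 2?case: ifP.
    have [q1 e1 c1] := mod2_cases v.1; have [q2 e2 c2] := mod2_cases v.2.
    have m12 : ((v.1 + v.2) %% 2)%Z = (((v.1 %% 2)%Z + (v.2 %% 2)%Z) %% 2)%Z by lia.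
    rewrite /= m12.
    (* The residue (0,1) has to be rotated to its representative (1,0); the other residues need only
       a translation. *)
    have [c0|c0] := boolP (((v.1 %% 2)%Z == 0) && ((v.2 %% 2)%Z == 1)).
      exists ((q1, q2), @Ordinal 4 3 isT); rewrite conjE // (@act_mx2 3 _ ls _ _ _ _ gen4_2).
      rewrite (_ : - _ = @Ordinal 4 1 isT); last exact: val_inj.
      rewrite (@act_mx2 3 _ _ _ _ _ _ gen4_1); case/andP: c0 => /eqP m1 /eqP m2.
      by rewrite m1 m2 in e1 e2 *; congr pair; (apply: vec_eq => /=; lia) || apply: val_inj.
    exists (tr 3 (q1, q2)); rewrite conj_tr // (@act_mx2 3 _ ls _ _ _ _ gen4_2).
    by case: c1 c2 e1 e2 c0 => -> [] -> e1 e2 c0 //; congr pair;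
      (apply: vec_eq => /=; lia) || apply: val_inj.
  + split; first by rewrite /=; lia.
    have [q e c] := mod2_cases (v.1 + v.2); exists (tr 3 (q - v.2, q)).
    rewrite conj_tr // (@act_mx2 3 _ ls _ _ _ _ gen4_3).
    by case: c e => -> e; congr pair; (apply: vec_eq => /=; lia) || apply: val_inj.
- by move=> i; do 8?[case: i => [|i] //] => _; split.
Qed.
End Four.

Lemma gen6_1 : gen 6 ^+ 1 = mx2 0 (-1) 1 1. Proof. gen_power. Qed.
Lemma gen6_2 : gen 6 ^+ 2 = mx2 (-1) (-1) 1 0. Proof. gen_power. Qed.
Lemma gen6_3 : gen 6 ^+ 3 = mx2 (-1) 0 0 (-1). Proof. gen_power. Qed.
Lemma gen6_4 : gen 6 ^+ 4 = mx2 0 1 (-1) (-1). Proof. gen_power. Qed.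
Lemma gen6_5 : gen 6 ^+ 5 = mx2 1 1 (-1) 0. Proof. gen_power. Qed.

Section Six.
Notation T := (basis 6).

Definition cl6 (s : 'I_6) (v : vec) : nat :=
  if s == 1%N :> nat then 1
  else if s == 5%N :> nat then 2
  else if s == 3%N :> nat then
    if ((v.1 %% 2)%Z == 0) && ((v.2 %% 2)%Z == 0) then 7 else 8
  else if ((v.1 - v.2) %% 3)%Z == 0 then s.+1 else s.+2.
Definition reps6 : seq T :=
  [:: (0, 0); ((0, 0), @Ordinal 6 1 isT); ((0, 0), @Ordinal 6 5 isT);
      ((0, 0), @Ordinal 6 2 isT); ((1, 0), @Ordinal 6 2 isT);
      ((0, 0), @Ordinal 6 4 isT); ((1, 0), @Ordinal 6 4 isT);
      ((0, 0), @Ordinal 6 3 isT); ((1, 0), @Ordinal 6 3 isT)].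

(** Order 6 gives a trivial quotient; order 3 gives Z/3, where -1 identifies 1 and 2; g = -1 gives
    (Z/2)^2, whose nonzero elements Gamma permutes transitively: 1 + 2 + 4 + 2 classes. *)
Lemma HH0_6 theta : irrational theta -> HH_crossed theta 6 0 9.
Proof.
move=> irr; apply: (@HH0_classes theta 5 isT irr 8 cl6 (nth (g1 5) reps6)) => //.
- move=> s v w; rewrite /cl6; case: s => [[|[|[|[|[|[|//]]]]]] ls] // _.
  + by rewrite (@act_mx2 5 _ ls _ _ _ _ gen6_2) /=; congr (if _ then _ else _); apply/eqP/eqP; lia.
  + rewrite (@act_mx2 5 _ ls _ _ _ _ gen6_3) /=.
    by congr (if _ then _ else _); apply/andP/andP => -[/eqP ? /eqP ?]; split; apply/eqP; lia.
  + by rewrite (@act_mx2 5 _ ls _ _ _ _ gen6_4) /=; congr (if _ then _ else _); apply/eqP/eqP; lia.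
- move=> s v _; rewrite /cl6 /gen /= /act_vec !mxE /=; do 3?[case: ifP => // _].
    by congr (if _ then _ else _); apply/andP/andP => -[/eqP ? /eqP ?]; split; apply/eqP; lia.
  by congr (if _ then _ else _); apply/eqP/eqP; lia.
- have e3 : - @Ordinal 6 3 isT = @Ordinal 6 3 isT :> 'I_6 by exact: val_inj.
  move=> s v; rewrite /cl6; case: s => [[|[|[|[|[|[|//]]]]]] ls] // _ /=.
  + split=> //; exists (tr 5 (- v.2, v.1 + v.2)).
    rewrite conj_tr // (@act_mx2 5 _ ls _ _ _ _ gen6_1).
    by congr pair; (apply: vec_eq => /=; lia) || apply: val_inj.
  + split; first by case: ifP.
    have [q e c] := mod3_cases (v.1 - v.2); case: c e => -> e.
    * exists (tr 5 (q, v.2 + q)); rewrite conj_tr // (@act_mx2 5 _ ls _ _ _ _ gen6_2).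
      by congr pair; (apply: vec_eq => /=; lia) || apply: val_inj.
    * exists (tr 5 (q, v.2 + q)); rewrite conj_tr // (@act_mx2 5 _ ls _ _ _ _ gen6_2).
      by congr pair; (apply: vec_eq => /=; lia) || apply: val_inj.
    (* The extra (1,1) in the translation turns the residue 2 into -1, which conjugation by the
       central element -1 sends to 1. *)
    * exists ((q + 1, v.2 + q + 1), @Ordinal 6 3 isT).
      rewrite conjE // e3 (@act_mx2 5 _ ls _ _ _ _ gen6_2) (@act_mx2 5 _ _ _ _ _ _ gen6_3).
      by congr pair; (apply: vec_eq => /=; lia) || apply: val_inj.
  + split; first by case: ifP.
    have [q1 m1 c1] := mod2_cases v.1; have [q2 m2 c2] := mod2_cases v.2.
    case: c1 c2 m1 m2 => -> [] -> m1 m2.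
    * exists (tr 5 (q1, q2)); rewrite conj_tr // (@act_mx2 5 _ ls _ _ _ _ gen6_3).
      by congr pair; (apply: vec_eq => /=; lia) || apply: val_inj.
    * exists ((q1, q2), @Ordinal 6 1 isT); rewrite conjE // (@act_mx2 5 _ ls _ _ _ _ gen6_3).
      rewrite (_ : - _ = @Ordinal 6 5 isT); last exact: val_inj.
      rewrite (@act_mx2 5 _ _ _ _ _ _ gen6_5).
      by congr pair; (apply: vec_eq => /=; lia) || apply: val_inj.
    * exists (tr 5 (q1, q2)); rewrite conj_tr // (@act_mx2 5 _ ls _ _ _ _ gen6_3).
      by congr pair; (apply: vec_eq => /=; lia) || apply: val_inj.
    (* The shift by 1 reaches (-1,1) instead of (1,1), and the fourth power of the generator maps it
       to (1,0). *)
    * exists ((q1 + 1, q2), @Ordinal 6 2 isT); rewrite conjE // (@act_mx2 5 _ ls _ _ _ _ gen6_3).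
      rewrite (_ : - _ = @Ordinal 6 4 isT); last exact: val_inj.
      rewrite (@act_mx2 5 _ _ _ _ _ _ gen6_4).
      by congr pair; (apply: vec_eq => /=; lia) || apply: val_inj.
  + split; first by case: ifP.
    have [q e c] := mod3_cases (v.1 - v.2); case: c e => -> e.
    * exists (tr 5 (v.2 + 2 * q, - q)); rewrite conj_tr // (@act_mx2 5 _ ls _ _ _ _ gen6_4).
      by congr pair; (apply: vec_eq => /=; lia) || apply: val_inj.
    * exists (tr 5 (v.2 + 2 * q, - q)); rewrite conj_tr // (@act_mx2 5 _ ls _ _ _ _ gen6_4).
      by congr pair; (apply: vec_eq => /=; lia) || apply: val_inj.
    * exists ((v.2 + 2 * (q + 1), - (q + 1)), @Ordinal 6 3 isT).
      rewrite conjE // e3 (@act_mx2 5 _ ls _ _ _ _ gen6_4) (@act_mx2 5 _ _ _ _ _ _ gen6_3).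
      by congr pair; (apply: vec_eq => /=; lia) || apply: val_inj.
  + split=> //; exists (tr 5 (v.1 + v.2, - v.1)).
    rewrite conj_tr // (@act_mx2 5 _ ls _ _ _ _ gen6_5).
    by congr pair; (apply: vec_eq => /=; lia) || apply: val_inj.
- by move=> i; do 9?[case: i => [|i] //] => _; split.
Qed.
End Six.

Theorem theorem2p1 (theta : Rdefinitions.R) (Htheta : irrational theta) :
  [/\ HH_crossed theta 3 0 7, HH_crossed theta 4 0 8, HH_crossed theta 6 0 9 &
      forall k : nat, k \in [:: 3; 4; 6]%N ->
        [/\ HH_crossed theta k 1 0, HH_crossed theta k 2 1 &
            forall n : nat, (3 < n)%N -> HH_crossed theta k n 0]].
Proof.
split; [exact: HH0_3 | exact: HH0_4 | exact: HH0_6 |].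
case=> [//|k] HK; split; [exact: HH_vanish | exact: HH2 |].
by case=> [|n] ln //; apply: HH_vanish => //; rewrite gtn_eqF // ltnW.
Qed.
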